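(* Let $K$ be one of the following totally complex quartic number fields (here $\zeta_\mu$ denotes a primitive $\mu$-th root of unity, and $\zeta_4=\imath$): (1) $\mathbb{Q}(\zeta_\mu)$ with $\mu\in\{5,8,12\}$; (2) $\mathbb{Q}(\gamma)$ where $\gamma$ is a root of one of the polynomials $X^4-X+1$, $X^4+X^2-X+1$, $X^4+2X^2-2X+1$ $(\dagger)$, $X^4-X^3+X+1$ $(\ddagger)$, $X^4-X^3+X^2+X+1$ $(\ddagger)$, $X^4-X^3+2X^2-X+2$ $(\dagger)$; (3) $\mathbb{Q}(\sqrt{a+b\zeta_4})$ with $(a,b)\in\{(1,1),(1,2),(1,4),(7,4)\,(\dagger)\}$; (4) $\mathbb{Q}(\sqrt{a+b\zeta_3})$ with $(a,b)\in\{(2,1),(4,1),(8,1),(3,2),(4,3),(7,3),(11,3),(5,4),(9,4),(13,4),(12,5),(11,7),(9,8),(15,11),(19,11)\,(\dagger),(17,12)\,(\dagger),(17,16)\,(\dagger)\}$; (5) $\mathbb{Q}(\zeta_4,\sqrt{5})$, or $\mathbb{Q}(\zeta_3,\sqrt{d})$ with $d\in\{5,6,21\}$; (6) $\mathbb{Q}\big(\sqrt{-1-\sqrt2}\big)$ or $\mathbb{Q}\big(\sqrt{-\tfrac{1+\sqrt5}{2}}\big)$. Then $\omega(K)\le 3$. Moreover, every field in this list not marked with $(\dagger)$ or $(\ddagger)$ is a DUG-field (equivalently $\omega(K)=1$); every field marked with $(\dagger)$ satisfies $\omega(K)\le 2$; and every field marked with $(\ddagger)$ satisfies $\omega(K)\le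 3$.
   Context: For an order $\mathfrak{o}$ of a number field $K$ and $\alpha\in\mathfrak{o}$: if $\alpha$ can be written as $\alpha=a_1\epsilon_1+\cdots+a_\ell\epsilon_\ell$ with pairwise distinct units $\epsilon_1,\dots,\epsilon_\ell\in\mathfrak{o}^*$ and positive integers $a_1\ge\cdots\ge a_\ell>0$, the unit sum height $\omega(\alpha)$ is the minimal possible value of $a_1$ over all such representations; $\omega(0)=0$, and $\omega(\alpha)=\infty$ if $\alpha$ is not a sum of units. Put $\omega(\mathfrak{o})=\max\{\omega(\alpha):\alpha\in\mathfrak{o}\}$ if this maximum exists (otherwise $\omega(\mathfrak{o})=\omega$ if $\mathfrak{o}$ is generated by units, and $\infty$ otherwise). $\omega(K)$ denotes $\omega(\mathfrak{o})$ for the maximal order (ring of integers) $\mathfrak{o}$ of $K$. A number field $K$ is a DUG-field (distinct unit generated) if every algebraic integer of $K$ is a sum of distinct units of $K$. *)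

(* Defs.v *)
From HB Require Import structures.
From mathcomp Require Import all_boot all_order all_algebra all_field.
From mathcomp Require Import boolp.
Set Implicit Arguments.
Unset Strict Implicit.
Unset Printing Implicit Defensive.
Import Order.TTheory GRing.Theory Num.Theory.
Local Open Scope ring_scope.

(* The value set N ∪ {ω, ∞} of unit sum heights, ordered 0 < 1 < ... < ω < ∞. *)
Inductive height := Fin of nat | Omega | Infty.

Definition height_le (g h : height) : bool :=
  match g, h with
  | Fin m, Fin n => (m <= n)%N
  | Fin _, _ | Omega, Omega | _, Infty => true
  | _, _ => false
  end.

Section UnitSumHeight.
Variables (K : fieldExtType rat) (o : K -> Prop).

Definition unit_of (e : K) : Prop := o e /\ exists2 f, o f & e * f = 1.

(* The list [:: (a_1, e_1); ...; (a_l, e_l)], l >= 1, encodes the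
   representation x = a_1 e_1 + ... + a_l e_l. *)
Definition unit_sum_rep (x : K) (t : seq (nat * K)) : Prop :=
  [/\ t <> [::],
      uniq (unzip2 t) /\ (forall e, e \in unzip2 t -> unit_of e),
      sorted geq (unzip1 t),
      (forall a, a \in unzip1 t -> (0 < a)%N) &
      x = \sum_(p <- t) p.2 *+ p.1].

Definition has_unit_sum_rep (x : K) (n : nat) : Prop :=
  exists2 t, unit_sum_rep x t & head 0%N (unzip1 t) = n.

Definition omega_elt (x : K) : height :=
  if x == 0 then Fin 0
  else match pselect (exists n, `[< has_unit_sum_rep x n >]) with
       | left ex_n => Fin (ex_minn ex_n)
       | right _ => Infty
       end.

Definition is_max_omega_elt (h : height) : Prop :=
  (exists2 x, o x & omega_elt x = h) /\
  (forall x, o x -> height_le (omega_elt x) h).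

Definition unit_generated : Prop :=
  forall x, o x ->
    exists2 s : seq K, (forall e, e \in s -> unit_of e) & x = \sum_(e <- s) e.

(* If some element has height ∞, then the maximum is ∞, which is also the
   value for an order that is not generated by units. *)
Definition omega_order : height :=
  match pselect (exists h, is_max_omega_elt h) with
  | left ex_h => projT1 (cid ex_h)
  | right _ => if `[< unit_generated >] then Omega else Infty
  end.

End UnitSumHeight.

Definition maximal_order (K : fieldExtType rat) (x : K) : Prop :=
  integralOver (intr : int -> K) x.

Definition omega_field (K : fieldExtType rat) : height :=
  omega_order (@maximal_order K).

Definition DUG_field (K : fieldExtType rat) : Prop :=
  forall x : K, maximal_order x ->
    exists s : seq K,
      [/\ uniq s, forall e, e \in s -> unit_of (@maximal_order K) e &
          x = \sum_(e <- s) e].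

(* K is isomorphic to the subfield Q(s) of the algebraic numbers. *)
Definition is_Qadjoin (K : fieldExtType rat) (s : seq algC) : Prop :=
  exists (iota : {rmorphism K -> algC}) (t : seq K),
    map iota t = s /\ <<1 & t>>%VS = fullv.

Inductive mark := Unmarked | Dagger | DoubleDagger.

(* listed s m: the field Q(s) occurs in the list with mark m. *)
Inductive listed : seq algC -> mark -> Prop :=
| RootOfUnity (mu : nat) (z : algC) :
    mu \in [:: 5; 8; 12]%N -> mu.-primitive_root z ->
    listed [:: z] Unmarked
| Quartic (p : {poly algC}) (g : algC) :
    p \in [:: 'X^4 - 'X + 1; 'X^4 + 'X^2 - 'X + 1] -> root p g ->
    listed [:: g] Unmarked
| QuarticDagger (p : {poly algC}) (g : algC) :
    p \in [:: 'X^4 + 2 *: 'X^2 - 2 *: 'X + 1;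
              'X^4 - 'X^3 + 2 *: 'X^2 - 'X + 2%:P] -> root p g ->
    listed [:: g] Dagger
| QuarticDoubleDagger (p : {poly algC}) (g : algC) :
    p \in [:: 'X^4 - 'X^3 + 'X + 1; 'X^4 - 'X^3 + 'X^2 + 'X + 1] ->
    root p g ->
    listed [:: g] DoubleDagger
| SqrtGauss (a b : nat) :
    (a, b) \in [:: (1, 1); (1, 2); (1, 4)]%N ->
    listed [:: sqrtC (a%:R + b%:R * 'i)] Unmarked
| SqrtGaussDagger :
    listed [:: sqrtC (7 + 4 * 'i)] Dagger
| SqrtEisenstein (a b : nat) (z : algC) :
    (a, b) \in [:: (2, 1); (4, 1); (8, 1); (3, 2); (4, 3); (7, 3); (11, 3);
                   (5, 4); (9, 4); (13, 4); (12, 5); (11, 7); (9, 8);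
                   (15, 11)]%N ->
    3.-primitive_root z ->
    listed [:: sqrtC (a%:R + b%:R * z)] Unmarked
| SqrtEisensteinDagger (a b : nat) (z : algC) :
    (a, b) \in [:: (19, 11); (17, 12); (17, 16)]%N -> 3.-primitive_root z ->
    listed [:: sqrtC (a%:R + b%:R * z)] Dagger
| BiquadGauss :
    listed [:: 'i; sqrtC 5] Unmarked
| BiquadEisenstein (d : nat) (z : algC) :
    d \in [:: 5; 6; 21]%N -> 3.-primitive_root z ->
    listed [:: z; sqrtC d%:R] Unmarked
| SqrtSilver :
    listed [:: sqrtC (- 1 - sqrtC 2)] Unmarked
| SqrtGolden :
    listed [:: sqrtC (- ((1 + sqrtC 5) / 2))] Unmarked.

(* Main.v *)
(** The units used are u e^k, where u runs over a finite set of roots of unity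
    containing 1 and closed under negation, and e is a unit of infinite order;
    a digit is a combination of the u with coefficients in 0, ..., w.  Let E be the set
    of the finite sums over k in Z of d_k e^k with digits d_k.  Since the units
    generate the ring of integers, E is the whole ring as soon as E + u is
    contained in E.  Adding u to d_0 may leave the set of digits; the excess is
    split into a carry q moving to the right and a carry q' moving to the left,
    d_0 + u = d + e q + e^-1 q'.  A carry q is absorbed by the expansion x of
    nonnegative exponents if q + x is again such an expansion, and
    q + (d + e x) = d' + e (q' + x) if d' = d + q - e q'.  So the sets of absorbed
    carries, among finitely many carries fixed in advance, can be followed by a
    finite automaton reading the digits; it remains to check on a finite family
    of such sets that the left and right carries can always be chosen.

    The ring of integers is found as follows.  If b is an integral basis
    candidate of discriminant D and x is integral with coordinates c_k, then
    D c_k^2 is an integer, so m x is in the order of b if m^2 is the largest square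
    dividing D.  A prime p dividing m can be removed when no nonzero residue a
    modulo p has all the powers (a / p)^k of denominator dividing m. *)
From Stdlib Require Import ZArith NArith Lia.
From HB Require Import structures.
From mathcomp Require Import all_boot all_order all_algebra all_field.
From mathcomp Require Import boolp ring zify ssrZ.
Require Import Defs.
Set Implicit Arguments.
Unset Strict Implicit.
Unset Printing Implicit Defensive.
Import Order.TTheory GRing.Theory Num.Theory.
Local Open Scope ring_scope.
(* MathComp rebinds the key %Z to its own type int. *)
Delimit Scope Z_scope with ZZ.

(** * Unit sum heights *)

Section Heights.
Variables (K : fieldExtType rat) (o : K -> Prop).

(** Coefficients may vanish and come in any order, so that an expansion with zero digits is directly
    such a sum. *)
Definition bounded_unit_sum (w : nat) (x : K) : Prop :=
  exists t : seq (nat * K),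
    [/\ uniq (unzip2 t), forall e, e \in unzip2 t -> unit_of o e,
        forall a, a \in unzip1 t -> (a <= w)%N &
        x = \sum_(p <- t) p.2 *+ p.1].

(** Dropping the zero coefficients and sorting the others decreasingly gives a representation with
    head at most [w]; it is nonempty when [x] is nonzero. *)
Lemma omega_elt_le (w : nat) (x : K) :
  bounded_unit_sum w x -> height_le (omega_elt o x) (Fin w).
Proof.
case=> t [uniq_t unit_t le_t xE]; rewrite /omega_elt; case: eqP => // /eqP x_neq0.
pose geq1 (p q : nat * K) := (q.1 <= p.1)%N.
pose s := sort geq1 [seq p <- t | 0 < p.1]%N.
have sub_t: {subset s <= t}.
  by move=> p; rewrite mem_sort mem_filter => /andP[].
have sumE: x = \sum_(p <- s) p.2 *+ p.1.
  rewrite (perm_big _ (permEl (perm_sort _ _))) /= big_filter xE.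
  rewrite [LHS](bigID (fun p => 0 < p.1)%N) /= [X in _ + X]big1 ?addr0 //.
  by move=> p; rewrite -leqNgt leqn0 => /eqP->; rewrite mulr0n.
have srep : unit_sum_rep o x s.
  split=> //.
  - by move=> s0; rewrite sumE s0 big_nil eqxx in x_neq0.
  - split; last by move=> e /mapP[p /sub_t ps ->]; apply/unit_t/map_f.
    rewrite (perm_uniq (perm_map _ (permEl (perm_sort _ _)))).
    exact: subseq_uniq (map_subseq _ (filter_subseq _ _)) uniq_t.
  - rewrite sorted_map; apply: sort_sorted => p q; exact: leq_total.
  - by move=> a /mapP[p]; rewrite mem_sort mem_filter => /andP[p_gt0 _] ->.
have hle : (head 0%N (unzip1 s) <= w)%N.
  case sE: s => [|p s'] //=; apply/le_t/map_f/sub_t.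
  by rewrite sE mem_head.
case: pselect => [ex_n|[]]; last first.
  by exists (head 0%N (unzip1 s)); apply/asboolP; exists s.
case: ex_minnP => n _ minn_n; rewrite /=; apply: leq_trans hle.
by apply: minn_n; apply/asboolP; exists s.
Qed.

Lemma height_le_Fin (w : nat) (x : K) :
  height_le (omega_elt o x) (Fin w) ->
  exists2 n, omega_elt o x = Fin n & (n <= w)%N.
Proof. by case: (omega_elt o x) => // n le_nw; exists n. Qed.

(** The heights form a set of natural numbers bounded by [w], nonempty because it contains the
    height of 0. *)
Lemma max_omega_elt_exists (w : nat) :
  o 0 -> (forall x, o x -> height_le (omega_elt o x) (Fin w)) ->
  exists h, is_max_omega_elt o h.
Proof.
move=> o0 le_w.
pose P n := `[< exists2 x, o x & omega_elt o x = Fin n >].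
have exP : exists n, P n by exists 0%N; apply/asboolP; exists 0; rewrite // /omega_elt eqxx.
have leP n : P n -> (n <= w)%N.
  by move=> /asboolP[x /le_w + xn]; rewrite xn.
exists (Fin (ex_maxn exP leP)); case: ex_maxnP => n /asboolP Pn max_n; split=> // x ox.
have [m xm _] := height_le_Fin (le_w x ox).
by rewrite xm; apply: max_n; apply/asboolP; exists x.
Qed.

Lemma omega_order_le (w : nat) :
  o 0 -> (forall x, o x -> height_le (omega_elt o x) (Fin w)) ->
  height_le (omega_order o) (Fin w).
Proof.
move=> o0 le_w; rewrite /omega_order; case: pselect => [ex_h|[]]; last first.
  exact: max_omega_elt_exists le_w.
by case: cid => h /= [[x ox <-] _]; apply: le_w.
Qed.

Lemma omega_order_eq1 :
  o 0 -> o 1 -> (forall x, o x -> height_le (omega_elt o x) (Fin 1)) ->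
  omega_order o = Fin 1.
Proof.
move=> o0 o1 le1; rewrite /omega_order; case: pselect => [ex_h|[]]; last first.
  exact: max_omega_elt_exists le1.
case: cid => h /= [[x ox <-] xmax].
have [n xn le_n1] := height_le_Fin (le1 x ox).
suff: (0 < n)%N by case: n le_n1 xn => [|[|n]].
suff: height_le (Fin 1) (omega_elt o x) by rewrite xn.
(* The lower bound comes from the element 1: it is nonzero, so the first coefficient of any
   representation is positive. *)
suff <- : omega_elt o 1 = Fin 1 by apply: xmax.
have [m m1 le_m1] := height_le_Fin (le1 1 o1); rewrite m1.
case: m m1 le_m1 => [|[|m]] //; rewrite /omega_elt oner_eq0.
case: pselect => // ex_n; case: ex_minnP => n' /asboolP[t [t0 _ _ pos_t _] <-] _ [].
case: t t0 pos_t => [|p t] // _ pos_t /= p0.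
by have := pos_t p.1 (mem_head _ _); rewrite p0.
Qed.

End Heights.

Lemma maximal_order_DUG (K : fieldExtType rat) :
  (forall x : K, maximal_order x -> bounded_unit_sum (@maximal_order K) 1 x) ->
  DUG_field K.
Proof.
move=> rep x /rep[t [uniq_t unit_t le_t ->]].
exists (unzip2 [seq p <- t | 0 < p.1]%N); split.
- exact: subseq_uniq (map_subseq _ (filter_subseq _ _)) uniq_t.
- move=> e /mapP[p]; rewrite mem_filter => /andP[_ pt] ->.
  by apply/unit_t/map_f.
rewrite big_map big_filter [LHS](bigID (fun p => 0 < p.1)%N) /=.
rewrite [X in _ + X]big1 ?addr0; last first.
  by move=> p; rewrite -leqNgt leqn0 => /eqP->; rewrite mulr0n.
rewrite big_seq_cond [RHS]big_seq_cond; apply: eq_bigr => p /andP[pt p_gt0].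
suff -> : p.1 = 1%N by rewrite mulr1n.
by apply/eqP; rewrite eqn_leq p_gt0 andbT; apply/le_t/map_f.
Qed.

Lemma maximal_order_le (K : fieldExtType rat) (w : nat) :
  (forall x : K, maximal_order x -> bounded_unit_sum (@maximal_order K) w x) ->
  height_le (omega_field K) (Fin w).
Proof.
move=> rep; apply: omega_order_le; first exact: integral0.
by move=> x /rep; apply: omega_elt_le.
Qed.

Lemma maximal_order_eq1 (K : fieldExtType rat) :
  (forall x : K, maximal_order x -> bounded_unit_sum (@maximal_order K) 1 x) ->
  omega_field K = Fin 1.
Proof.
move=> rep; apply: omega_order_eq1; [exact: integral0|exact: integral1|].
by move=> x /rep; apply: omega_elt_le.
Qed.

(** * Traces in a number field *)

Section Trace.
Variables (K : fieldExtType rat) (n : nat) (b : n.+1.-tuple K).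
Hypothesis basis_b : basis_of fullv b.

Definition mulM (x : K) : 'M[rat]_n.+1 :=
  \matrix_(i, j) coord b j (x * b`_i).

Definition trK (x : K) : rat := \tr (mulM x).

Lemma coord_sum (x : K) : x = \sum_j coord b j x *: b`_j.
Proof. exact: coord_basis basis_b (memvf x). Qed.

Lemma coord_inj (x y : K) : (forall j, coord b j x = coord b j y) -> x = y.
Proof.
by move=> eq_xy; rewrite (coord_sum x) (coord_sum y); apply: eq_bigr => j _; rewrite eq_xy.
Qed.

Lemma mulM_is_linear : linear mulM.
Proof.
by move=> a x y; apply/matrixP => i j; rewrite !mxE mulrDl linearD -scalerAl linearZ.
Qed.

HB.instance Definition _ := GRing.isLinear.Build rat K 'M[rat]_n.+1 _ mulM mulM_is_linear.

Lemma mulM1 : mulM 1 = 1%:M.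
Proof.
apply/matrixP => i j; by rewrite !mxE mul1r coord_free ?(basis_free basis_b) // eq_sym.
Qed.

Lemma mulMM (x y : K) : mulM (x * y) = mulM x *m mulM y.
Proof.
apply/matrixP => i j; rewrite !mxE [x * y]mulrC -mulrA [x * _]coord_sum mulr_sumr.
rewrite linear_sum.
by apply: eq_bigr => k _; rewrite -scalerAr linearZ /= !mxE.
Qed.

Lemma mulM_horner (x : K) (p : {poly rat}) :
  mulM (map_poly (in_alg K) p).[x] = horner_mx (mulM x) p.
Proof.
elim/poly_ind: p => [|p c IHp]; first by rewrite !rmorph0 horner0 linear0.
rewrite !rmorphD !rmorphM /= map_polyX map_polyC hornerD hornerM hornerX hornerC.
by rewrite linearD /= mulMM IHp horner_mx_X horner_mx_C linearZ /= mulM1 scalemx1.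
Qed.

Lemma trK_is_scalar : scalar trK.
Proof. by move=> a x y; rewrite /trK !linearP. Qed.

HB.instance Definition _ := GRing.isLinear.Build rat K rat *%R trK trK_is_scalar.

(** The numbers [r] are the eigenvalues of the multiplication matrix. A rational polynomial killing
    [x] kills this matrix, so it is a multiple of the minimal polynomial of the matrix and vanishes
    at every eigenvalue. *)
Lemma trK_roots (x : K) :
  exists r : seq algC, [/\ size r = n.+1, ratr (trK x) = \sum_(z <- r) z &
    forall p : {poly rat}, (map_poly (in_alg K) p).[x] = 0 ->
      forall z, z \in r -> root (map_poly ratr p) z].
Proof.
pose N : 'M[algC]_n.+1 := map_mx ratr (mulM x).
have [r rE] := closed_field_poly_normal (char_poly N).
rewrite (monicP (char_poly_monic N)) scale1r in rE.
have szr : size r = n.+1.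
  by have := size_char_poly N; rewrite rE size_prod_XsubC => -[].
exists r; split=> //.
  have := char_poly_trace N isT; rewrite rE.
  rewrite -{1}szr coefPn_prod_XsubC ?szr // => /oppr_inj ->.
  by rewrite /N trace_map_mx.
move=> p px0 z zr.
have /mxminpoly_min : horner_mx N (map_poly ratr p) = 0.
  by rewrite -map_horner_mx -mulM_horner px0 linear0 map_mx0.
rewrite -dvdp_XsubCl; apply: dvdp_trans.
by rewrite dvdp_XsubCl root_mxminpoly rE root_prod_XsubC.
Qed.

(** The trace is rational and a sum of algebraic integers. *)
Lemma trK_int (x : K) : integralOver (intr : int -> K) x -> trK x \in Num.int.
Proof.
case=> p mon_p px0; have [r [_ trE rootr]] := trK_roots x.
rewrite -Cint_rat; apply: Cint_rat_Aint; first exact: Crat_rat.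
rewrite trE big_seq; apply: rpred_sum => z zr.
have := rootr (map_poly intr p); rewrite -map_poly_comp.
have -> : map_poly (in_alg K \o intr) p = map_poly intr p :> {poly K}.
  by apply: eq_map_poly => c; apply: (rmorph_int (in_alg K)).
move=> /(_ (rootP px0) z zr); rewrite -map_poly_comp.
have -> : map_poly (ratr \o intr) p = map_poly intr p :> {poly algC}.
  by apply: eq_map_poly => c; apply: (rmorph_int (@ratr algC)).
move/root_monic_Aint; apply; first by rewrite monic_map.
by apply/polyOverP => i; rewrite coef_map /=.
Qed.

(** All eigenvalues are roots of unity. The bound serves to recognize units of infinite order by a
    power of large trace. *)
Lemma trK_unity (x : K) (m : nat) : (0 < m)%N -> x ^+ m = 1 -> `|trK x| <= n.+1%:R.
Proof.
move=> m_gt0 xm1; have [r [szr trE rootr]] := trK_roots x.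
have norm1 z : z \in r -> `|z| = 1.
  move=> zr; have := rootr ('X^m - 1).
  rewrite rmorphB rmorph1 /= map_polyXn !hornerE xm1 subrr => /(_ erefl z zr).
  rewrite rmorphB rmorph1 /= map_polyXn rootE !hornerE subr_eq0 => /eqP zm1.
  by apply/eqP; rewrite -(@pexpr_eq1 _ _ m) // -normrX zm1 normr1.
rewrite -(ler_rat algC) ratr_norm trE rmorph_nat.
apply: le_trans (ler_norm_sum _ _ _) _; rewrite big_seq (eq_bigr (fun=> 1)) //.
by rewrite -big_seq big_const_seq count_predT szr iter_addr_0.
Qed.

(* Replacing b_k by x multiplies the discriminant by the square of the k-th coordinate. *)
Lemma disc_coord_int (x : K) (k : 'I_n.+1) :
  (forall i : 'I_n.+1, integralOver (intr : int -> K) b`_i) ->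
  integralOver (intr : int -> K) x ->
  \det (\matrix_(i < n.+1, j < n.+1) trK (b`_i * b`_j)) * coord b k x ^+ 2
    \in Num.int.
Proof.
move=> int_b int_x; set G := \matrix_(_, _) _.
pose b' (i : 'I_n.+1) := if i == k then x else b`_i.
have int_b' i : integralOver (intr : int -> K) (b' i) by rewrite /b'; case: eqP.
pose C : 'M[rat]_n.+1 := \matrix_(i, j) coord b j (b' i).
have -> : \det G * coord b k x ^+ 2 = \det (C *m G *m C^T).
  rewrite !det_mulmx det_tr.
  (* [C] is the identity matrix except for row [k], which holds the coordinates of [x]. *)
  suff -> : \det C = coord b k x by ring.
  rewrite (expand_det_row _ k) (bigD1 k) //= big1 ?addr0.
    rewrite mxE /b' eqxx /cofactor addnn -signr_odd odd_double expr0 mul1r.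
    suff -> : row' k (col' k C) = 1%:M by rewrite det1 mulr1.
    apply/matrixP => i j; rewrite !mxE /b' eq_sym (negPf (neq_lift _ _)).
    by rewrite coord_free ?(basis_free basis_b) // (inj_eq lift_inj) eq_sym.
  move=> j jk; rewrite /cofactor.
  suff -> : \det (row' k (col' j C)) = 0 by rewrite !mulr0.
  (* The only nonzero entry of row [j] is in column [j]; with this column removed, the row [i0] of
     the minor, which comes from row [j], is zero. *)
  have [i0 jE _] : {i | j = lift k i & unlift k j = Some i}.
    by apply: unlift_some; rewrite eq_sym.
  rewrite (expand_det_row _ i0) big1 // => l _; rewrite !mxE /b' -jE (negPf jk).
  rewrite coord_free ?(basis_free basis_b) // eq_sym.
  by rewrite eq_sym (negPf (neq_lift _ _)) mul0r.
(* The product is the Gram matrix of the trace form on the integral family [b']. *)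
suff -> : C *m G *m C^T = \matrix_(i, j) trK (b' i * b' j).
  by apply: rpred_sum => s _; rewrite rpredMsign; apply: rpred_prod => i _;
    rewrite mxE; apply/trK_int/integral_mul.
have G1 i j : (C *m G) i j = trK (b' i * b`_j).
  rewrite mxE [in RHS](coord_sum (b' i)) mulr_suml linear_sum; apply: eq_bigr => l _.
  by rewrite !mxE -scalerAl linearZ.
apply/matrixP => i j; rewrite !mxE [in RHS](coord_sum (b' j)) mulr_sumr linear_sum.
by apply: eq_bigr => l _; rewrite G1 !mxE -scalerAr linearZ mulrC.
Qed.

End Trace.

(** * Irreducible integer quartics *)

(** Quadruples serve both as coordinates in a basis and as the coefficients of a monic quartic below
    the leading one, constant term first. *)
Definition vec : Type := (Z * Z * Z * Z)%type.

Definition zrange (n : Z) : seq Z :=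
  [seq (Z.of_nat i - n)%ZZ | i <- iota 0 (Z.to_nat (2 * n + 1))].

Lemma mem_zrange (n a : Z) : (Z.abs a <= n)%ZZ -> a \in zrange n.
Proof.
move=> le_an; apply/mapP; exists (Z.to_nat (a + n)); last by lia.
by rewrite mem_iota; lia.
Qed.

Lemma Zabs_le_mul (b d : Z) : (b * d <> 0)%ZZ -> (Z.abs b <= Z.abs (b * d))%ZZ.
Proof.
move=> bd; have d_gt0 : (1 <= Z.abs d)%ZZ.
  suff: (d <> 0)%ZZ by lia.
  by move=> d0; apply: bd; rewrite d0 Z.mul_0_r.
by rewrite Z.abs_mul; have := Z.abs_nonneg b; nia.
Qed.

(* For a factorization (X^2 + a X + b) (X^2 + c X + d), the sum a + c = f3 and the
   product a c = f2 - b - d bound |a|. *)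
Definition irreducible4 (f : vec) : bool :=
  let: (f0, f1, f2, f3) := f in
  let bs := zrange (Z.abs f0) in
  let ads := zrange (Z.abs f2 + Z.abs f3 + 2 * Z.abs f0) in
  [&& ~~ (f0 =? 0)%ZZ,
      all (fun r => ~~ ((((r + f3) * r + f2) * r + f1) * r + f0 =? 0)%ZZ) bs &
      all (fun b => all (fun d => (b * d =? f0)%ZZ ==>
        all (fun a => ~~ ((b + d + a * (f3 - a) =? f2)
                      && (a * d + b * (f3 - a) =? f1))%ZZ) ads) bs) bs].

(** An integer root divides the nonzero constant term, so it lies in the searched range. *)
Lemma irreducible4_root (f0 f1 f2 f3 r : Z) : irreducible4 (f0, f1, f2, f3) ->
  ((((r + f3) * r + f2) * r + f1) * r + f0 <> 0)%ZZ.
Proof.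
case/and3P=> f0_neq0 /allP noroot _ fr0.
suff /mem_zrange/noroot : (Z.abs r <= Z.abs f0)%ZZ by rewrite fr0.
set q := (((r + f3) * r + f2) * r + f1)%ZZ in fr0.
have f0E : (f0 = - (q * r))%ZZ by lia.
have q_neq0 : (q <> 0)%ZZ by move=> q0; move: f0_neq0; rewrite f0E q0.
by rewrite f0E Z.abs_opp Z.abs_mul; nia.
Qed.

Lemma irreducible4_quadratic (f0 f1 f2 f3 a b c d : Z) :
  irreducible4 (f0, f1, f2, f3) -> (b * d = f0)%ZZ -> (a * d + b * c = f1)%ZZ ->
  (b + d + a * c = f2)%ZZ -> (a + c = f3)%ZZ -> False.
Proof.
case/and3P=> f0_neq0 _ /allP noquad bd adbc bdac ac.
have {f0_neq0} f0_neq0 : (f0 <> 0)%ZZ by apply/Z.eqb_neq/negbTE.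
have leb : (Z.abs b <= Z.abs f0)%ZZ by rewrite -bd; apply: Zabs_le_mul; rewrite bd.
have led : (Z.abs d <= Z.abs f0)%ZZ.
  by rewrite -bd Z.mul_comm; apply: Zabs_le_mul; rewrite Z.mul_comm bd.
have /allP/(_ d (mem_zrange led)) := noquad b (mem_zrange leb).
rewrite bd Z.eqb_refl /= => /allP/(_ a).
have cE : c = (f3 - a)%ZZ by lia.
rewrite -cE bdac adbc !Z.eqb_refl /= => noa.
suff /mem_zrange/noa : (Z.abs a <= Z.abs f2 + Z.abs f3 + 2 * Z.abs f0)%ZZ by [].
have acE : (Z.abs a * Z.abs c <= Z.abs f2 + 2 * Z.abs f0)%ZZ by rewrite -Z.abs_mul; lia.
have := Z.abs_nonneg f2; have := Z.abs_nonneg f3; have := Z.abs_nonneg f0.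
(* If [c] is 0 then [a] is [f3]; if both are nonzero then [|a| <= |a c|]. *)
have [c0|c0] := Z.eq_dec c 0; first by lia.
have [a0|a0] := Z.eq_dec a 0; first by lia.
by nia.
Qed.

Definition quartic (f : vec) : {poly int} :=
  let: (f0, f1, f2, f3) := f in
  Poly [:: int_of_Z f0; int_of_Z f1; int_of_Z f2; int_of_Z f3; 1].

Lemma size_quartic (f : vec) : size (quartic f) = 5.
Proof. by case: f => [[[f0 f1] f2] f3]; rewrite (PolyK (c := 0)). Qed.

Lemma coef_quartic (f0 f1 f2 f3 : Z) i :
  Z_of_int (quartic (f0, f1, f2, f3))`_i = nth 0%ZZ [:: f0; f1; f2; f3; 1%ZZ] i.
Proof.
rewrite coef_Poly; do 5?[case: i => [|i]; rewrite /= ?int_of_ZK //].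
by rewrite !nth_nil.
Qed.

Lemma irreducible4_factor (f : vec) (p r : {poly int}) :
  irreducible4 f -> quartic f = p * r -> (1 < size p)%N -> (1 < size r)%N -> False.
Proof.
wlog le_pr : p r / (size p <= size r)%N.
  move=> wl irr_f; have [/wl|/ltnW/wl wl'] := leqP (size p) (size r); first exact.
  by rewrite mulrC => *; apply: wl'.
move=> irr_f fE p_gt1 r_gt1.
have sz : (size p + size r).-1 = 5.
  have p_neq0 : p != 0 by rewrite -size_poly_gt0 ltnW.
  have r_neq0 : r != 0 by rewrite -size_poly_gt0 ltnW.
  by rewrite -size_mul // -fE size_quartic.
case: f irr_f fE => [[[f0 f1] f2] f3] irr_f fE.
pose P i := Z_of_int p`_i; pose Q i := Z_of_int r`_i.
have P0 i : (size p <= i)%N -> P i = 0%ZZ by move=> le_pi; rewrite /P nth_default.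
have Q0 i : (size r <= i)%N -> Q i = 0%ZZ by move=> le_pi; rewrite /Q nth_default.
have cE i : nth 0%ZZ [:: f0; f1; f2; f3; 1%ZZ] i = \sum_(j < i.+1) P j * Q (i - j)%N.
  rewrite -coef_quartic fE coefM rmorph_sum; apply: eq_bigr => j _; exact: rmorphM.
have := (cE 0, cE 1, cE 2, cE 3, cE 4)%N.
rewrite !big_ord_recl !big_ord0 /bump /= !subn0 /= ?subnn => -[[[[E0 E1] E2] E3] E4].
(* The factor [p] of smaller degree is linear or quadratic. The leading coefficients multiply to 1,
   so both are 1 or both are -1; the second case only changes signs. *)
have [szp|szp] : (size p = 2)%N \/ (size p = 3)%N by lia.
  have szr : size r = 4 by lia.
  rewrite (P0 2%N) ?szp // (P0 3%N) ?szp // (P0 4%N) ?szp // (Q0 4%N) ?szr // in E0 E1 E2 E3 E4.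
  clear -irr_f E0 E1 E2 E3 E4; move: (P 0) (P 1) (Q 0) (Q 1) (Q 2) (Q 3) E0 E1 E2 E3 E4.
  move=> p0 p1 q0 q1 q2 q3; rewrite /GRing.add /GRing.mul /GRing.zero /= => E0 E1 E2 E3 E4.
  have [p1E|p1E] : (p1 = 1 \/ p1 = -1)%ZZ by apply: Z.eq_mul_1 (q3) _; lia.
    have q3E : q3 = 1%ZZ by lia.
    by apply: (irreducible4_root (r := Z.opp p0) irr_f); subst; lia.
  have q3E : q3 = (-1)%ZZ by lia.
  by apply: (irreducible4_root (r := p0) irr_f); subst; lia.
have szr : size r = 3 by lia.
rewrite (P0 3%N) ?szp // (P0 4%N) ?szp // (Q0 3%N) ?szr // (Q0 4%N) ?szr // in E0 E1 E2 E3 E4.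
clear -irr_f E0 E1 E2 E3 E4; move: (P 0) (P 1) (P 2) (Q 0) (Q 1) (Q 2) E0 E1 E2 E3 E4.
move=> p0 p1 p2 q0 q1 q2; rewrite /GRing.add /GRing.mul /GRing.zero /= => E0 E1 E2 E3 E4.
have [p2E|p2E] : (p2 = 1 \/ p2 = -1)%ZZ by apply: Z.eq_mul_1 (q2) _; lia.
  have q2E : q2 = 1%ZZ by lia.
  by apply: (@irreducible4_quadratic _ _ _ _ p1 p0 q1 q0 irr_f); subst; lia.
have q2E : q2 = (-1)%ZZ by lia.
by apply: (@irreducible4_quadratic _ _ _ _ (Z.opp p1) (Z.opp p0) (Z.opp q1) (Z.opp q0) irr_f);
  subst; lia.
Qed.

(** If the minimal polynomial of [x] over the rationals had degree below 4, Gauss's lemma would turn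
    it into a proper factor of the quartic over the integers. *)
Lemma irreducible4_dim (K : fieldExtType rat) (f : vec) (x : K) :
  irreducible4 f -> root (map_poly intr (quartic f)) x -> (4 <= \dim {:K})%N.
Proof.
move=> irr_f fx0.
have /polyOver1P[q qE] := minPolyOver 1 x.
have minE : map_poly (in_alg K) q = minPoly 1 x by rewrite qE.
have szq : size q = (adjoin_degree 1 x).+1 by rewrite -(size_map_poly (in_alg K)) minE size_minPoly.
have dvd_q : q %| map_poly intr (quartic f).
  rewrite -(dvdp_map (in_alg K)) minE minPoly_dvdp //.
    by apply/polyOver1P; exists (map_poly intr (quartic f)).
  rewrite -map_poly_comp; congr (root _ x): fx0; apply: eq_map_poly => c.
  exact/esym/(rmorph_int (in_alg K)).
have [q1 [a a_neq0 q1E] [r rE]] := dvdpP_rat_int dvd_q.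
have szq1 : size q1 = size q.
  by rewrite q1E size_scale // size_map_inj_poly // ?rmorph0 //; apply: intr_inj.
have deg_gt0 : (0 < adjoin_degree 1 x)%N by rewrite adjoin_degreeE /= dimv1 divn1 adim_gt0.
rewrite leqNgt; apply/negP => dimK.
have deg_lt4 : (adjoin_degree 1 x < 4)%N.
  by rewrite adjoin_degreeE /= dimv1 divn1 (leq_ltn_trans _ dimK) // dimvS ?subvf.
apply: (irreducible4_factor irr_f rE); first by rewrite szq1 szq.
have := size_quartic f; rewrite rE.
have q1_neq0 : q1 != 0 by rewrite -size_poly_gt0 szq1 szq.
have [->|r_neq0] := eqVneq r 0; first by rewrite mulr0 size_poly0.
rewrite size_mul // szq1 szq; move: deg_lt4; move: (adjoin_degree _ _) (size r) => d m.
by rewrite addSn /= => ltd4 dm; rewrite -(ltn_add2l d) dm ltnS addn1.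
Qed.

(** * Integer coordinates *)

(** The certificates are evaluated on binary integers; this morphism carries the results into the
    field. *)
Definition zin (R : nzRingType) : Z -> R := intr \o int_of_Z.
HB.instance Definition _ (R : nzRingType) := GRing.RMorphism.on (@zin R).

Lemma zinD (R : nzRingType) (a b : Z) : zin R (a + b)%ZZ = zin R a + zin R b.
Proof. exact: rmorphD. Qed.
Lemma zinN (R : nzRingType) (a : Z) : zin R (- a)%ZZ = - zin R a.
Proof. exact: rmorphN. Qed.
Lemma zinB (R : nzRingType) (a b : Z) : zin R (a - b)%ZZ = zin R a - zin R b.
Proof. exact: rmorphB. Qed.
Lemma zinM (R : nzRingType) (a b : Z) : zin R (a * b)%ZZ = zin R a * zin R b.
Proof. exact: rmorphM. Qed.
Lemma zin0 (R : nzRingType) : zin R 0%ZZ = 0. Proof. exact: rmorph0. Qed.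
Lemma zin1 (R : nzRingType) : zin R 1%ZZ = 1. Proof. exact: rmorph1. Qed.
Lemma zinN1 (R : nzRingType) : zin R (-1)%ZZ = -1. Proof. exact: rmorphN1. Qed.
Definition zinE := (zinD, zinN, zinB, zinM, zin0, zin1, zinN1).

Lemma zin_inj (R : numDomainType) : injective (zin R).
Proof. by move=> a b /intr_inj/(can_inj int_of_ZK). Qed.

Lemma int_zin (x : rat) : x \in Num.int -> exists z, x = zin rat z.
Proof. by move/intrP=> [n ->]; exists (Z_of_int n); rewrite /zin /= Z_of_intK. Qed.

Definition vadd (u v : vec) : vec :=
  let: (a, b, c, d) := u in let: (a', b', c', d') := v in
  (a + a', b + b', c + c', d + d')%ZZ.
Definition vopp (u : vec) : vec :=
  let: (a, b, c, d) := u in (- a, - b, - c, - d)%ZZ.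
Definition vsub (u v : vec) : vec := vadd u (vopp v).
Definition vscale (k : Z) (u : vec) : vec :=
  let: (a, b, c, d) := u in (k * a, k * b, k * c, k * d)%ZZ.
Definition vdiv (u : vec) (k : Z) : vec :=
  let: (a, b, c, d) := u in (a / k, b / k, c / k, d / k)%ZZ.
Definition vmod (u : vec) (k : Z) : vec :=
  let: (a, b, c, d) := u in (a mod k, b mod k, c mod k, d mod k)%ZZ.
Definition v2s (u : vec) : seq Z := let: (a, b, c, d) := u in [:: a; b; c; d].
Definition v0 : vec := (0, 0, 0, 0)%ZZ.
Definition unitv (i : nat) : vec :=
  nth v0 [:: (1, 0, 0, 0); (0, 1, 0, 0); (0, 0, 1, 0); (0, 0, 0, 1)]%ZZ i.

Definition trv (mul : vec -> vec -> vec) (u : vec) : Z :=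
  foldr Z.add 0%ZZ [seq nth 0%ZZ (v2s (mul u (unitv i))) i | i <- iota 0 4].

(** The minor on rows 1, 2, 3, written out so that the discriminant can be evaluated. *)
Definition det3 (R : nzRingType) (m : nat -> nat -> R) (j0 j1 j2 : nat) : R :=
  m 1 j0 * (m 2 j1 * m 3 j2 - m 2 j2 * m 3 j1)
  - m 1 j1 * (m 2 j0 * m 3 j2 - m 2 j2 * m 3 j0)
  + m 1 j2 * (m 2 j0 * m 3 j1 - m 2 j1 * m 3 j0).

Definition det4 (R : nzRingType) (m : nat -> nat -> R) : R :=
  m 0 0 * det3 m 1 2 3 - m 0 1 * det3 m 0 2 3
  + m 0 2 * det3 m 0 1 3 - m 0 3 * det3 m 0 1 2.

Lemma det4E (R : comNzRingType) (m : nat -> nat -> R) :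
  \det (\matrix_(i < 4, j < 4) m i j) = det4 m.
Proof.
rewrite /det4 /det3; do 3!(rewrite ?(expand_det_row _ ord0) ?big_ord_recl ?big_ord0 /cofactor).
rewrite !det_mx11 !mxE /bump /=.
by rewrite !(expr0, expr1, exprS, mulr1, mul1r, addr0); ring.
Qed.

Definition discv (mul : vec -> vec -> vec) : Z :=
  det4 (fun i j => trv mul (mul (unitv i) (unitv j))).

(** * Maximality of an order *)

Definition squarefreeZ (s : Z) : bool :=
  ~~ Z.eqb s 0 &&
  all (fun i => let d := Z.of_nat i in ~~ Z.eqb (s mod (d * d)) 0) (iota 2 (Z.to_nat (Z.abs s))).

(** Throughout, [x / pk] is a power of [a / p]. The search succeeds once [m] times such a power has
    a coordinate that is not an integer. *)
Fixpoint power_escapes (mul : vec -> vec -> vec) (m p : Z) (a x : vec) (pk : Z)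
    (fuel : nat) : bool :=
  if fuel is fuel'.+1 then
    if all (fun c => Z.eqb ((m * c) mod pk) 0) (v2s x)
    then power_escapes mul m p a (mul x a) (pk * p) fuel'
    else true
  else false.

Definition residues (p : Z) : seq vec :=
  let r := [seq Z.of_nat i | i <- iota 0 (Z.to_nat p)] in
  [seq (abc, d) | abc <- [seq (ab, c) | ab <- [seq (a, b) | a <- r, b <- r], c <- r],
                  d <- r].

Definition maximal_at (mul : vec -> vec -> vec) (m p : Z) : bool :=
  (0 <? p)%ZZ &&
  all (fun a => (a == v0) || power_escapes mul m p a a p 64) (residues p).

Definition maximal_check (mul : vec -> vec -> vec) (ps : seq Z) : bool :=
  let m := foldr Z.mul 1%ZZ ps in
  let s := (discv mul / (m * m))%ZZ in
  [&& Z.eqb (s * (m * m)) (discv mul), squarefreeZ s & all (maximal_at mul m) ps].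

(** With [c] in lowest terms, the square of the denominator is coprime to that of the numerator, so
    it divides [s]. *)
Lemma squarefreeZP (s : Z) (c : rat) :
  squarefreeZ s -> zin rat s * c ^+ 2 \in Num.int -> c \in Num.int.
Proof.
case/andP=> s_neq0 /allP sqf.
have {}s_neq0 : s <> 0%ZZ by apply/Z.eqb_neq/negbTE.
have d_neq0 : (denq c)%:~R != 0 :> rat by rewrite intr_eq0 denq_eq0.
case/intrP=> k kE.
have sE : int_of_Z s * numq c ^+ 2 = k * denq c ^+ 2.
  apply: (@intr_inj rat); rewrite !expr2 !rmorphM /= -kE.
  by rewrite -{3}(divq_num_den c) /zin /=; field.
have dvd_s : (denq c ^+ 2 %| int_of_Z s)%Z.
  have : (denq c ^+ 2 %| int_of_Z s * numq c ^+ 2)%Z by rewrite sE dvdz_mull.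
  rewrite Gauss_dvdzl // coprimezXl // coprimezXr // coprimez_sym.
  by rewrite /coprimez /gcdz; have := coprime_num_den c; rewrite /coprime => /eqP->.
rewrite Qint_def; have [d dE] : exists d, denq c = Posz d by exists `|denq c|%N; rewrite absz_denq.
rewrite dE in dvd_s *; have d_gt0 : (0 < d)%N by rewrite -ltz_nat -dE denq_gt0.
have [d1|d_neq1] := eqVneq d 1%N; first by rewrite d1.
have [q sq] := dvdzP dvd_s.
have {}sq : s = (Z_of_int q * (Z.of_nat d * Z.of_nat d))%ZZ.
  by rewrite -[LHS]int_of_ZK sq rmorphM rmorphXn expr2.
have : (Z.of_nat d * Z.of_nat d <= Z.abs s)%ZZ.
  rewrite sq Z.abs_mul [Z.abs (_ * Z.of_nat d)%ZZ]Z.abs_eq; last by lia.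
  have : Z_of_int q <> 0%ZZ by move=> q0; apply: s_neq0; rewrite sq q0.
  by move: (Z_of_int q) => q' q'0; nia.
move=> le_ds; have /sqf : d \in iota 2 (Z.to_nat (Z.abs s)) by rewrite mem_iota; nia.
by rewrite /= {1}sq Z_mod_mult.
Qed.

Lemma zinK_inj (K : fieldExtType rat) : injective (zin K).
Proof.
move=> a b; rewrite /zin /= -!(rmorph_int (in_alg K)) => /(fmorph_inj (in_alg K)).
by move=> /intr_inj/(can_inj int_of_ZK).
Qed.

(** * Coordinates in the candidate basis and proof of maximality *)

Section MaximalOrder.
Variables (K : fieldExtType rat) (b1 b2 b3 : K) (mul : vec -> vec -> vec).

Definition vec_value (v : vec) : K :=
  let: (a, b, c, d) := v in zin K a + zin K b * b1 + zin K c * b2 + zin K d * b3.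

Local Notation ev := vec_value.
Hypothesis evM : forall u v, ev (mul u v) = ev u * ev v.
Hypothesis spanb : (fullv <= <<[:: 1%R; b1; b2; b3]>>)%VS.
Hypothesis dimK : (4 <= \dim {:K})%N.
Hypotheses (int1 : integralOver (intr : int -> K) b1)
  (int2 : integralOver (intr : int -> K) b2) (int3 : integralOver (intr : int -> K) b3).

Let b : 4.-tuple K := [tuple 1; b1; b2; b3].

Lemma basis_b : basis_of fullv b.
Proof. by rewrite basisEdim spanb. Qed.

Lemma ev0 : ev v0 = 0. Proof. by rewrite /vec_value /v0 !zinE; ring. Qed.

Lemma evD (u v : vec) : ev (vadd u v) = ev u + ev v.
Proof. by case: u v => [[[? ?] ?] ?] [[[? ?] ?] ?]; rewrite /vec_value /= !zinE; ring. Qed.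

Lemma evN (u : vec) : ev (vopp u) = - ev u.
Proof. by case: u => [[[? ?] ?] ?]; rewrite /vec_value /= !zinE; ring. Qed.

Lemma evB (u v : vec) : ev (vsub u v) = ev u - ev v.
Proof. by rewrite evD evN. Qed.

Lemma evZ (k : Z) (u : vec) : ev (vscale k u) = zin K k * ev u.
Proof. by case: u => [[[? ?] ?] ?]; rewrite /vec_value /= !zinE; ring. Qed.

Lemma zin_scale (k : Z) (x : K) : zin K k * x = zin rat k *: x.
Proof. by rewrite -[x in RHS]mul1r scalerAl /zin /= scaler_int. Qed.

Lemma ev_sum (v : vec) : ev v = \sum_(i < 4) zin rat (nth 0%ZZ (v2s v) i) *: b`_i.
Proof.
case: v => [[[a b'] c] d]; rewrite /vec_value !big_ord_recl big_ord0 /= /bump /=.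
by rewrite -!zin_scale mulr1 addr0 !addrA.
Qed.

Lemma coord_ev (v : vec) (j : 'I_4) : coord b j (ev v) = zin rat (nth 0%ZZ (v2s v) j).
Proof.
rewrite ev_sum linear_sum (bigD1 j) //= big1 ?addr0.
  by rewrite linearZ /= coord_free ?(basis_free basis_b) // eqxx mulr1.
move=> i ij; rewrite linearZ /= coord_free ?(basis_free basis_b) //.
by rewrite (_ : (_ == _) = false) ?mulr0 //; apply: contraNF ij => /eqP ->.
Qed.

Lemma ev_inj : injective ev.
Proof.
move=> u v uv; have E (j : 'I_4) : nth 0%ZZ (v2s u) j = nth 0%ZZ (v2s v) j.
  by apply: (@zin_inj rat); rewrite -!coord_ev uv.
have := (E 0, E 1, E (inord 2), E (inord 3)); rewrite !inordK //=.
by case: u v {uv E} => [[[? ?] ?] ?] [[[? ?] ?] ?] /= [[[-> ->] ->] ->].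
Qed.

Lemma int_ev (v : vec) : integralOver (intr : int -> K) (ev v).
Proof.
case: v => [[[? ?] ?] ?]; rewrite /vec_value.
by do !(apply: integral_add || apply: integral_mul); rewrite // /zin; apply: integral_id.
Qed.

Lemma ev_unitv (i : 'I_4) : ev (unitv i) = b`_i.
Proof. by case: i => -[|[|[|[|]]]] // lti; rewrite /vec_value /= !zinE; ring. Qed.

Lemma trK_ev (v : vec) : trK b (ev v) = zin rat (trv mul v).
Proof.
rewrite /trK /mxtrace !big_ord_recl big_ord0 /trv /= !zinE.
by do 4![congr (_ + _); first by rewrite mxE -ev_unitv -evM coord_ev].
Qed.

Lemma disc_evE :
  \det (\matrix_(i < 4, j < 4) trK b (b`_i * b`_j)) = zin rat (discv mul).
Proof.
rewrite /discv -det4E -det_map_mx; congr (\det _); apply/matrixP => i j.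
by rewrite !mxE -!ev_unitv -evM trK_ev.
Qed.

Lemma ev_coord (x : K) :
  (forall j, coord b j x \in Num.int) -> exists v, x = ev v.
Proof.
move=> int_x; have [z zE] := choice (fun j => int_zin (int_x j)).
exists (z 0, z 1, z (inord 2), z (inord 3)).
apply: (coord_inj basis_b) => j; rewrite coord_ev zE; congr (zin _ _).
by case: j => -[|[|[|[|j]]]] // ltj /=; congr (z _); apply: val_inj; rewrite /= ?inordK.
Qed.

Lemma int_bi (i : 'I_4) : integralOver (intr : int -> K) b`_i.
Proof. by rewrite -ev_unitv; apply: int_ev. Qed.

Lemma integral_pow (x : K) n :
  integralOver (intr : int -> K) x -> integralOver (intr : int -> K) (x ^+ n).
Proof.
move=> int_x; elim: n => [|n IHn]; first by rewrite expr0; apply: integral1.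
by rewrite exprS; apply: integral_mul.
Qed.

(** Every [m y^n] lies in the order, so each divisibility test passes until the fuel is spent. *)
Lemma power_escapesP (m p : Z) (a x : vec) (pk : Z) (fuel n : nat) (y : K) :
  (forall n, exists v, zin K m * y ^+ n = ev v) -> (pk <> 0)%ZZ -> (p <> 0)%ZZ ->
  zin K p * y = ev a -> zin K pk * y ^+ n = ev x ->
  ~~ power_escapes mul m p a x pk fuel.
Proof.
move=> my pk_neq0 p_neq0 pyE; elim: fuel n x pk pk_neq0 => //= fuel IHf n x pk pk_neq0 pkE.
have [v vE] := my n.
have mxE : vscale m x = vscale pk v.
  by apply: ev_inj; rewrite !evZ -vE -pkE; ring.
have -> : all (fun c => Z.eqb ((m * c) mod pk) 0) (v2s x).
  move: mxE; case: x v {pkE vE} => [[[x1 x2] x3] x4] [[[w1 w2] w3] w4] /= [-> -> -> ->].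
  by rewrite ![(pk * _)%ZZ]Z.mul_comm !Z_mod_mult.
apply: (IHf n.+1); first by nia.
by rewrite evM -pkE -pyE !zinE exprS; ring.
Qed.

Lemma mem_residues (p : Z) (v : vec) : (0 < p)%ZZ -> vmod v p \in residues p.
Proof.
case: v => [[[a b'] c] d] p_gt0 /=.
have mem x : (x mod p)%ZZ \in [seq Z.of_nat i | i <- iota 0 (Z.to_nat p)].
  have := Z.mod_pos_bound x p p_gt0; move: (x mod p)%ZZ => r r_bound.
  by apply/mapP; exists (Z.to_nat r); rewrite ?mem_iota; lia.
by apply: (allpairs_f pair); rewrite ?mem //; apply: (allpairs_f pair);
  rewrite ?mem //; apply: (allpairs_f pair); rewrite mem.
Qed.

(** Subtracting the quotient of [v] by [p] leaves an integral element equal to a residue divided by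
    [p]. A nonzero residue would have a power with denominator not dividing [m]. *)
Lemma maximal_atP (m p : Z) (y : K) :
  maximal_at mul m p ->
  (forall n (y' : K), integralOver (intr : int -> K) y' ->
     exists v, zin K m * y' ^+ n = ev v) ->
  integralOver (intr : int -> K) y -> (exists v, zin K p * y = ev v) ->
  exists v, y = ev v.
Proof.
case/andP=> /Z.ltb_lt p_gt0 /allP escapes my int_y [v vE].
have vmE : v = vadd (vmod v p) (vscale p (vdiv v p)).
  case: v {vE} => [[[x1 x2] x3] x4] /=.
  by congr (_, _, _, _); rewrite Z.add_comm -Z.div_mod //; lia.
pose y' := y - ev (vdiv v p).
have int_y' : integralOver (intr : int -> K) y'.
  by apply: integral_sub => //; apply: int_ev.
have y'E : zin K p * y' = ev (vmod v p).
  by rewrite /y' mulrBr vE {1}vmE evD evZ; ring.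
have p_neq0 : (p <> 0)%ZZ by lia.
have /orP[/eqP a0|] := escapes _ (mem_residues v p_gt0).
  exists (vdiv v p); apply/eqP; rewrite -subr_eq0 -/y'.
  move/eqP: y'E; rewrite a0 ev0 mulf_eq0 => /orP[|//].
  by rewrite -(zin0 K) (inj_eq (@zinK_inj K)) => /eqP.
rewrite (negPf (@power_escapesP _ _ _ _ _ _ 1 _ _ p_neq0 p_neq0 y'E _)) ?expr1 //.
by move=> n; apply: my.
Qed.

Lemma maximal_checkP (ps : seq Z) (x : K) :
  maximal_check mul ps -> integralOver (intr : int -> K) x -> exists v, x = ev v.
Proof.
rewrite /maximal_check; set m := foldr _ _ _; set s := (_ / _)%ZZ.
case/and3P=> /Z.eqb_eq sE sqf_s maxp int_x.
have mint (y : K) : integralOver (intr : int -> K) y -> exists v, zin K m * y = ev v.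
  move=> int_y; apply: ev_coord => j; rewrite zin_scale linearZ /=.
  (* For a coordinate [c] of [y], the discriminant times [c^2] is [s] times the square of [m c]. *)
  apply: (squarefreeZP sqf_s).
  have := disc_coord_int basis_b j int_bi int_y; rewrite disc_evE -sE !zinE.
  by rewrite exprMn -mulrA -expr2.
have mpow n (y : K) : integralOver (intr : int -> K) y -> exists v, zin K m * y ^+ n = ev v.
  by move=> int_y; apply/mint/integral_pow.
(* The primes are removed one at a time, while the bound [m] on the denominators of powers stays
   fixed. *)
have strip qs : all (maximal_at mul m) qs ->
    (exists v, zin K (foldr Z.mul 1%ZZ qs) * x = ev v) -> exists v, x = ev v.
  elim: qs => [_|p qs IHqs] /=; first by rewrite zin1 mul1r.
  case/andP=> max_p /IHqs{}IHqs; rewrite zinM -mulrA => ev_px; apply: IHqs.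
  by apply: (maximal_atP max_p mpow _ ev_px); apply: integral_mul => //; apply: integral_id.
by apply: (strip ps) => //; apply: mint.
Qed.

End MaximalOrder.

(** * Signed expansions and their automata *)

Lemma zin_nat (R : nzRingType) (n : nat) : zin R (Z.of_nat n) = n%:R.
Proof.
rewrite /zin /=; suff -> : int_of_Z (Z.of_nat n) = Posz n by [].
by apply: (can_inj Z_of_intK); rewrite int_of_ZK.
Qed.

Definition digits (us : seq vec) (w : nat) : seq vec :=
  foldr (fun u ds => undup [seq vadd (vscale (Z.of_nat c) u) d | c <- iota 0 w.+1, d <- ds])
    [:: v0] us.

(** A set of carries is encoded as a binary number, bit [i] standing for the [i]-th carry of the
    list. *)
Definition bits (T : Type) (f : T -> bool) (xs : seq T) : N :=
  foldr (fun x acc => if f x then N.succ_double acc else N.double acc) 0%num xs.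

Definition meets (m n : N) : bool := ~~ N.eqb (N.land m n) 0.
Definition submask (m n : N) : bool := N.eqb (N.land m n) m.

(** A table lists the mask of successors of each carry under one digit; the result is the set of
    carries with a successor in [S]. *)
Definition pre (tab : seq N) (S : N) : N := bits (meets S) tab.

(** Nested conditionals stop at the first difference even under call-by-value evaluation. *)
Definition veqb (u v : vec) : bool :=
  let: (a, b, c, d) := u in let: (a', b', c', d') := v in
  if Z.eqb d d' then if Z.eqb c c' then if Z.eqb b b' then Z.eqb a a'
  else false else false else false.

Fixpoint vmem (u : vec) (vs : seq vec) : bool :=
  if vs is v :: vs' then if veqb u v then true else vmem u vs' else false.

Definition vbox (k : Z) (vs : seq vec) : vec :=
  vscale k (foldr (fun v acc =>
    let: (a, b, c, d) := v in let: (a', b', c', d') := acc in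
    (Z.max (Z.abs a) a', Z.max (Z.abs b) b', Z.max (Z.abs c) c', Z.max (Z.abs d) d')) v0 vs).

Definition in_box (B u : vec) : bool :=
  let: (a, b, c, d) := u in let: (a', b', c', d') := B in
  if Z.leb (Z.abs d) d' then if Z.leb (Z.abs c) c' then if Z.leb (Z.abs b) b'
  then Z.leb (Z.abs a) a' else false else false else false.

(* The box only filters out differences that are too large to be digit differences. *)
Definition keep_box (B u : vec) : option vec := if in_box B u then Some u else None.

Definition mem_digit (f : vec -> vec) (ds : seq vec) (o : option vec) : bool :=
  if o is Some x then vmem (f x) ds else false.

(** The differences [q - e q'] are shared by all digits: reading [d] leads from [q] to [q'] when
    [d + q - e q'] is a digit. *)
Definition links (mul : vec -> vec -> vec) (e : vec) (ds qs : seq vec) :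
    seq (seq (option vec)) :=
  let eqs := [seq mul e q | q <- qs] in
  let B := vbox 2 ds in
  [seq [seq keep_box B (vsub q q') | q' <- eqs] | q <- qs].

Definition transitions (ds : seq vec) (rows : seq (seq (option vec))) (d : vec) : seq N :=
  [seq bits (mem_digit (vadd d) ds) row | row <- rows].

(** Carries absorbed by the empty expansion: first 0, then those that lead to one already found on
    reading the digit 0. The 24 rounds bound the length of the expansions tried. *)
Definition start_mask (tab0 : seq N) (qs : seq vec) : N :=
  iter 24 (fun S => N.lor S (pre tab0 S)) (bits (pred1 v0) qs).

(** A smaller mask is weaker information, so only minimal masks are kept: a mask containing a member
    of the family is dropped, and a new mask replaces those containing it. [closed_family] tests the
    outcome. *)
Fixpoint close (fuel : nat) (tabs : seq (seq N)) (todo fam : seq N) : seq N :=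
  if (fuel, todo) is (fuel'.+1, G :: todo') then
    let: (fam', new) :=
      foldl (fun acc tab => let: (fam, new) := acc in let H := pre tab G in
               if has (fun S => submask S H) fam then acc
               else (H :: [seq S <- fam | ~~ submask H S], H :: new))
        (fam, [::]) tabs in
    close fuel' tabs ([seq S <- todo' | S \in fam'] ++ new) fam'
  else fam.

Definition closed_family (tabs : seq (seq N)) (S0 : N) (fam : seq N) : bool :=
  has (fun S => submask S S0) fam &&
  all (fun G => all (fun tab => has (fun S => submask S (pre tab G)) fam) tabs) fam.

(** [x] runs over the sums of a digit and a unit that are not digits. Any mask of [famr] and any
    mask of [faml] must contain carries [q] and [q'] for which [x - e q - ei q'] is a digit. *)
Definition central (mul : vec -> vec -> vec) (e ei : vec) (us ds qr ql : seq vec)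
    (famr faml : seq N) : bool :=
  let eqs := [seq mul e q | q <- qr] in
  let B := vbox 3 ds in
  let rows := [seq let y := mul ei q' in [seq keep_box B (vadd y q) | q <- eqs] | q' <- ql] in
  all (fun x =>
    let tab := [seq bits (mem_digit (vsub x) ds) row | row <- rows] in
    all (fun R => let P := pre tab R in all (meets P) faml) famr)
  [seq x <- undup [seq vadd d u | d <- ds, u <- us] | ~~ vmem x ds].

Definition digits_check (mul : vec -> vec -> vec) (e ei : vec) (us : seq vec) (w : nat)
    (qr ql : seq vec) : bool :=
  let ds := digits us w in
  let rowr := links mul e ds qr in
  let rowl := links mul ei ds ql in
  let tabr := [seq transitions ds rowr d | d <- ds] in
  let tabl := [seq transitions ds rowl d | d <- ds] in
  let startr := start_mask (transitions ds rowr v0) qr in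
  let startl := start_mask (transitions ds rowl v0) ql in
  let famr := close 1000 tabr [:: startr] [:: startr] in
  let faml := close 1000 tabl [:: startl] [:: startl] in
  [&& closed_family tabr startr famr, closed_family tabl startl faml
    & central mul e ei us ds qr ql famr faml].

Lemma testbit_bits (T : Type) (x0 : T) (f : T -> bool) (xs : seq T) (i : nat) :
  N.testbit (bits f xs) (N.of_nat i) = (i < size xs)%N && f (nth x0 xs i).
Proof.
elim: xs i => [|x xs IHxs] [|i] /=.
- by [].
- by [].
- by case: (f x); rewrite ?N.testbit_odd_0 ?N.testbit_even_0; case: (bits f xs).
rewrite ltnS -IHxs -/(bits f xs) -[N.pos _]/(N.of_nat i.+1) Nat2N.inj_succ.
case: (f x); first by rewrite N.succ_double_spec N.testbit_odd_succ //; apply: N.le_0_l.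
by rewrite N.double_spec N.testbit_even_succ //; apply: N.le_0_l.
Qed.

Lemma meetsP (m n : N) :
  meets m n -> exists i : nat, N.testbit m (N.of_nat i) /\ N.testbit n (N.of_nat i).
Proof.
move=> mn; apply: contrapT => no; move/negP: mn; apply; apply/N.eqb_eq.
apply: N.bits_inj_0 => i; rewrite N.land_spec; apply/negP => /andP[mi ni]; apply: no.
by exists (N.to_nat i); rewrite N2Nat.id.
Qed.

Lemma testbit_submask (m n i : N) : submask m n -> N.testbit m i -> N.testbit n i.
Proof. by move/N.eqb_eq <-; rewrite N.land_spec => /andP[]. Qed.

Lemma veqbP (u v : vec) : veqb u v -> u = v.
Proof.
case: u v => [[[a b] c] d] [[[a' b'] c'] d'] /=.
case: (Z.eqb_spec d d') => // ->; case: (Z.eqb_spec c c') => // ->.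
by case: (Z.eqb_spec b b') => // ->; case: (Z.eqb_spec a a') => // ->.
Qed.

Lemma vmemP (u : vec) (vs : seq vec) : vmem u vs -> u \in vs.
Proof.
elim: vs => //= v vs IHvs; rewrite inE; case uv: (veqb u v).
  by rewrite (veqbP uv) eqxx.
by move/IHvs->; rewrite orbT.
Qed.

Lemma mem_digitP (f : vec -> vec) (ds : seq vec) (B u : vec) :
  mem_digit f ds (keep_box B u) -> f u \in ds.
Proof. by rewrite /keep_box; case: in_box => // /vmemP. Qed.

(** * Soundness of the automata and addition of units *)

Section Automaton.
Variables (K : fieldExtType rat) (b1 b2 b3 : K) (mul : vec -> vec -> vec).
Local Notation ev := (vec_value b1 b2 b3).
Hypothesis evM : forall u v, ev (mul u v) = ev u * ev v.

Lemma digitsP (us : seq vec) (w : nat) (d : vec) : d \in digits us w ->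
  exists c : nat -> nat, (forall j, c j <= w)%N /\
    ev d = \sum_(j <- iota 0 (size us)) ev (nth v0 us j) *+ c j.
Proof.
elim: us d => [|u us IHus] d.
  rewrite /= inE => /eqP->; exists (fun=> 0%N); split=> //.
  by rewrite big_nil ev0.
have -> : digits (u :: us) w =
  undup [seq vadd (vscale (Z.of_nat c) u) d | c <- iota 0 w.+1, d <- digits us w] by [].
rewrite mem_undup => /allpairsP[[k d'] [kw /IHus[c [cw dE]] ->]].
exists (fun j => if j is j'.+1 then c j' else k); split.
  by case=> [|j] //; move: kw; rewrite mem_iota.
have -> : iota 0 (size (u :: us)) = 0%N :: [seq j.+1 | j <- iota 0 (size us)].
  by rewrite -[LHS]/(0 :: iota (1 + 0) (size us)) iotaDl.
rewrite big_cons big_map evD evZ -dE; congr (_ + _).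
by rewrite zin_nat mulr_natl.
Qed.

(** Horner's scheme, with the digit of exponent 0 first. *)
Definition word_value (e : K) (s : seq vec) : K :=
  foldr (fun d acc => ev d + e * acc) 0 s.

Variable ds : seq vec.

Definition expansion (e x : K) : Prop :=
  exists2 s, {subset s <= ds} & x = word_value e s.

Lemma expansion_cons (e x : K) (d : vec) :
  d \in ds -> expansion e x -> expansion e (ev d + e * x).
Proof.
move=> dds [s sds ->]; exists (d :: s) => // d'.
by rewrite inE => /orP[/eqP->|/sds].
Qed.

(** The mask is a lower bound for the set of carries absorbed by [x], so it may be shrunk. *)
Definition accepted (e : K) (qs : seq vec) (S : N) (x : K) : Prop :=
  forall i, N.testbit S (N.of_nat i) -> (i < size qs)%N -> expansion e (ev (nth v0 qs i) + x).

Lemma accepted_sub (e : K) (qs : seq vec) (S S' : N) (x : K) :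
  submask S' S -> accepted e qs S x -> accepted e qs S' x.
Proof. by move=> SS' accS i /(testbit_submask SS'); apply: accS. Qed.

Lemma accepted_pre (e : vec) (qs : seq vec) (S : N) (x : K) (d : vec) :
  accepted (ev e) qs S x ->
  accepted (ev e) qs (pre (transitions ds (links mul e ds qs) d) S) (ev d + ev e * x).
Proof.
move=> accS i; rewrite (testbit_bits 0%num) !size_map => /andP[lti].
rewrite (nth_map [::]) ?size_map // (nth_map v0) // => /meetsP[j [Sj]].
rewrite (testbit_bits None) !size_map => /andP[ltj].
rewrite (nth_map v0) ?size_map // (nth_map v0) // => /mem_digitP d'ds _.
have := expansion_cons d'ds (accS j Sj ltj); congr expansion.
by rewrite evD evB evM; ring.
Qed.

(** The empty expansion can be prolonged by zero digits, so each round is a step of the automaton at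
    [d = 0] and [x = 0]. *)
Lemma accepted_start (e : vec) (qs : seq vec) :
  v0 \in ds ->
  accepted (ev e) qs (start_mask (transitions ds (links mul e ds qs) v0) qs) 0.
Proof.
move=> ds0; rewrite /start_mask; elim: 24%N => [|n IHn] i.
  rewrite (testbit_bits v0) => /andP[_ /eqP->] _; exists [::] => //.
  by rewrite ev0 addr0.
rewrite iterS N.lor_spec => /orP[]; first exact: IHn.
by have := @accepted_pre e qs _ 0 v0 IHn; rewrite ev0 mulr0 addr0; apply.
Qed.

(** Induction along the word from its highest exponent down: each digit leads to a mask that
    contains a member of the family. *)
Lemma closed_familyP (e : vec) (qs : seq vec) (fam : seq N) (x : K) :
  v0 \in ds ->
  closed_family [seq transitions ds (links mul e ds qs) d | d <- ds]
    (start_mask (transitions ds (links mul e ds qs) v0) qs) fam ->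
  expansion (ev e) x -> exists2 S, S \in fam & accepted (ev e) qs S x.
Proof.
move=> ds0 /andP[/hasP[S0 S0fam subS0] /allP clos] [s sds ->].
elim: s sds => [_|d s IHs sds] /=.
  by exists S0 => //; apply: accepted_sub subS0 _; apply: accepted_start.
have dds : d \in ds by apply: sds; rewrite mem_head.
have [|G Gfam accG] := IHs; first by move=> d' d's; apply: sds; rewrite inE d's orbT.
have /allP/(_ _ (map_f _ dds))/hasP[S Sfam subS] := clos G Gfam.
by exists S => //; apply: accepted_sub subS _; apply: accepted_pre.
Qed.

Variables (e ei : vec) (us qr ql : seq vec) (famr faml : seq N).
Hypotheses (eei : ev e * ev ei = 1) (ds0 : v0 \in ds).
Hypothesis closr : closed_family [seq transitions ds (links mul e ds qr) d | d <- ds]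
    (start_mask (transitions ds (links mul e ds qr) v0) qr) famr.
Hypothesis closl : closed_family [seq transitions ds (links mul ei ds ql) d | d <- ds]
    (start_mask (transitions ds (links mul ei ds ql) v0) ql) faml.
Hypothesis cent : central mul e ei us ds qr ql famr faml.
Hypothesis usN : forall u, u \in us -> vopp u \in us.

Let eie : ev ei * ev e = 1. Proof. by rewrite mulrC. Qed.

(** [y] carries the nonnegative exponents, [z] the negative ones, read away from the centre. *)
Definition laurent (x : K) : Prop :=
  exists y z, [/\ expansion (ev e) y, expansion (ev ei) z & x = y + ev ei * z].

Lemma expansion0 (f : K) : expansion f 0.
Proof. by exists [::]. Qed.

Lemma expansion_uncons (f x : K) : expansion f x ->
  exists d y, [/\ d \in ds, expansion f y & x = ev d + f * y].
Proof.
case=> -[|d s] sds ->.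
  by exists v0, 0; rewrite ev0 mulr0 addr0; split=> //; apply: expansion0.
exists d, (word_value f s); split=> //; first by apply: sds; rewrite mem_head.
by exists s => // d' d's; apply: sds; rewrite inE d's orbT.
Qed.

Lemma laurent0 : laurent 0.
Proof. by exists 0, 0; split; [exact: expansion0|exact: expansion0|rewrite mulr0 addr0]. Qed.

(** The digit of exponent -1 crosses over to the nonnegative part. *)
Lemma laurent_mule (x : K) : laurent x -> laurent (ev e * x).
Proof.
case=> y [z [exp_y /expansion_uncons[d [z' [dds exp_z' ->]]] ->]].
exists (ev d + ev e * y), z'; split=> //; first exact: expansion_cons.
by rewrite !mulrDr !mulrA eei; ring.
Qed.

Lemma laurent_mulei (x : K) : laurent x -> laurent (ev ei * x).
Proof.
case=> y [z [/expansion_uncons[d [y' [dds exp_y' ->]]] exp_z ->]].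
exists y', (ev d + ev ei * z); split=> //; first exact: expansion_cons.
by rewrite !mulrDr [ev ei * (ev e * _)]mulrA eie; ring.
Qed.

Lemma laurent_add (x : K) (u : vec) : u \in us -> laurent x -> laurent (x + ev u).
Proof.
move=> uus [y [z [/expansion_uncons[d [y' [dds exp_y' ->]]] exp_z ->]]].
have [/vmemP duds|duds] := boolP (vmem (vadd d u) ds).
  exists (ev (vadd d u) + ev e * y'), z; split=> //; first exact: expansion_cons.
  by rewrite evD; ring.
(* Here [d + u] is not a digit. [R] and [L] hold carries absorbed by the two sides, and [central]
   picks one from each so that what remains in the centre is a digit. *)
have [R Rfam accR] := closed_familyP ds0 closr exp_y'.
have [L Lfam accL] := closed_familyP ds0 closl exp_z.
have du : vadd d u \in [seq x <- undup [seq vadd d u | d <- ds, u <- us] | ~~ vmem x ds].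
  by rewrite mem_filter duds mem_undup; apply: allpairs_f.
have /allP/(_ _ Rfam)/allP/(_ _ Lfam)/meetsP[j [Pj Lj]] := allP cent _ du.
move: Pj; rewrite (testbit_bits 0%num) !size_map => /andP[ltj].
rewrite (nth_map [::]) ?size_map // (nth_map v0) // => /meetsP[i [Ri]].
rewrite (testbit_bits None) !size_map => /andP[lti].
rewrite (nth_map v0) ?size_map // (nth_map v0) // => /mem_digitP d'ds.
exists (ev (vsub (vadd d u) (vadd (mul ei (nth v0 ql j)) (mul e (nth v0 qr i))))
  + ev e * (ev (nth v0 qr i) + y')), (ev (nth v0 ql j) + z).
split; [by apply: expansion_cons => //; apply: accR|exact: accL|].
by rewrite evB !evD !evM; ring.
Qed.

Lemma laurent_expr (x : K) (n : nat) : laurent x -> laurent (ev e ^+ n * x).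
Proof.
move=> lx; elim: n => [|n IHn]; first by rewrite mul1r.
by rewrite exprS -mulrA; apply: laurent_mule.
Qed.

Lemma laurent_exprV (x : K) (n : nat) : laurent x -> laurent (ev ei ^+ n * x).
Proof.
move=> lx; elim: n => [|n IHn]; first by rewrite mul1r.
by rewrite exprS -mulrA; apply: laurent_mulei.
Qed.

(** Shifting by [n] places brings the added unit to exponent 0. *)
Lemma laurent_addX (x : K) (u : vec) (n : nat) :
  u \in us -> laurent x -> laurent (x + ev u * ev e ^+ n).
Proof.
move=> uus lx; have -> : x + ev u * ev e ^+ n = ev e ^+ n * (ev ei ^+ n * x + ev u).
  by rewrite mulrDr mulrA -exprMn eei expr1n mul1r mulrC.
by apply/laurent_expr/laurent_add/laurent_exprV.
Qed.

Lemma laurent_addZ (x : K) (k : Z) (u : vec) (n : nat) :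
  u \in us -> laurent x -> laurent (x + zin K k * (ev u * ev e ^+ n)).
Proof.
move=> uus lx; have lxn m v : v \in us -> laurent (x + (ev v * ev e ^+ n) *+ m).
  move=> vus; elim: m => [|m IHm]; first by rewrite addr0.
  by rewrite mulrSr addrA; apply: laurent_addX.
have [k_ge0|k_lt0] := Z_le_gt_dec 0 k.
  have -> : zin K k = (Z.to_nat k)%:R by rewrite -zin_nat Z2Nat.id.
  by rewrite mulr_natl; apply: lxn.
have -> : zin K k = - (Z.to_nat (- k))%:R.
  have kE : k = Z.opp (Z.of_nat (Z.to_nat (Z.opp k))) by lia.
  by rewrite {1}kE zinN zin_nat.
by rewrite mulNr mulr_natl -mulNrn -mulNr -evN; apply/lxn/usN.
Qed.

(** A power of [ei] is factored out: each digit of the negative part is put in front of the word. *)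
Lemma laurent_word (x : K) : laurent x ->
  exists n s, {subset s <= ds} /\ x = ev ei ^+ n * word_value (ev e) s.
Proof.
case=> y [z [[s sds ->] [t tds ->] ->]].
elim: t s tds sds => [|d t IHt] s tds sds /=.
  by exists 0%N, s; split=> //; rewrite mulr0 addr0 mul1r.
have [||n [s' [s'ds s'E]]] := IHt (d :: s).
- by move=> d' d't; apply: tds; rewrite inE d't orbT.
- by move=> d'; rewrite inE => /orP[/eqP->|/sds//]; apply: tds; rewrite mem_head.
exists n.+1, s'; split=> //; rewrite exprS -mulrA -s'E /= !mulrDr !mulrA eie; ring.
Qed.

End Automaton.

(** * Certificates *)

(* [prim] is a primitive element with minimal polynomial [minp]; the prime
   numbers in [sqp] have as product the square root of the largest square
   dividing the discriminant; the units of the expansions are [u * eps ^ k] with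
   [u] in [rts]; the right and left carries are the products of the elements of
   [rts] with the elements of [carr] and [carl]. *)
Record certificate := Certificate {
  prim : vec; minp : vec; sqp : seq Z; eps : vec; epsi : vec;
  rts : seq vec; hgt : nat; carr : seq vec; carl : seq vec }.

Definition vpow (mul : vec -> vec -> vec) (u : vec) (n : nat) : vec :=
  iter n (mul u) (unitv 0).

Definition carry_set (mul : vec -> vec -> vec) (us vs : seq vec) : seq vec :=
  undup (v0 :: [seq mul u v | v <- vs, u <- us]).

Definition quartic_value (mul : vec -> vec -> vec) (f x : vec) : vec :=
  let: (f0, f1, f2, f3) := f in
  vadd (vpow mul x 4) (vadd (vscale f3 (vpow mul x 3))
    (vadd (vscale f2 (vpow mul x 2)) (vadd (vscale f1 x) (vscale f0 (unitv 0))))).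

Definition order_check (mul : vec -> vec -> vec) (c : certificate) : bool :=
  [&& irreducible4 (minp c), quartic_value mul (minp c) (prim c) == v0 &
      maximal_check mul (sqp c)].

(** 60 is a common multiple of the orders 2, 4, 6, 10 of the roots of unity in use. A power of [eps]
    with trace above 4 in absolute value gives infinite order, and each basis element has to be one
    of the units, so that these generate the ring. *)
Definition units_check (mul : vec -> vec -> vec) (c : certificate) : bool :=
  [&& mul (eps c) (epsi c) == unitv 0, uniq (rts c),
      all (fun u => vopp u \in rts c) (rts c),
      all (fun u => vpow mul u 60 == unitv 0) (rts c),
      has (fun n => (4 <? Z.abs (trv mul (vpow mul (eps c) n)))%ZZ) (iota 1 8) &
      all (fun i => has (fun u => has (fun k => mul u (vpow mul (eps c) k) == unitv i)
                                    (iota 0 4)) (rts c)) (iota 0 4)].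

Definition expansion_check (mul : vec -> vec -> vec) (c : certificate) : bool :=
  (v0 \in digits (rts c) (hgt c)) &&
  digits_check mul (eps c) (epsi c) (rts c) (hgt c)
    (carry_set mul (rts c) (carr c)) (carry_set mul (rts c) (carl c)).

Definition field_check (mul : vec -> vec -> vec) (c : certificate) : bool :=
  [&& order_check mul c, units_check mul c & expansion_check mul c].

(** * From a checked certificate to bounded unit sums *)

Section Soundness.
Variables (K : fieldExtType rat) (b1 b2 b3 : K) (mul : vec -> vec -> vec).
Variable c : certificate.
Local Notation ev := (vec_value b1 b2 b3).
Hypothesis evM : forall u v, ev (mul u v) = ev u * ev v.
Hypothesis spanb : (fullv <= <<[:: 1%R; b1; b2; b3]>>)%VS.
Hypotheses (int1 : integralOver (intr : int -> K) b1)
  (int2 : integralOver (intr : int -> K) b2) (int3 : integralOver (intr : int -> K) b3).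
Hypothesis check_c : field_check mul c.

Lemma ev1 : ev (unitv 0) = 1.
Proof. by rewrite /unitv /= /vec_value !zinE; ring. Qed.

Lemma ev_pow (u : vec) (n : nat) : ev (vpow mul u n) = ev u ^+ n.
Proof. by elim: n => [|n IHn]; rewrite ?ev1 ?expr0 //= evM IHn exprS. Qed.

Lemma root_quartic (f x : vec) :
  quartic_value mul f x = v0 -> root (map_poly intr (quartic f)) (ev x).
Proof.
case: f => [[[f0 f1] f2] f3] /(congr1 ev); rewrite /quartic_value !evD !evZ !ev_pow ev1 ev0.
move=> fx0; apply/rootP; rewrite -[RHS]fx0 map_Poly horner_Poly /=.
by rewrite /zin /=; ring.
Qed.

Let ord_c : order_check mul c. Proof. by case/and3P: check_c. Qed.

Lemma dimK : (4 <= \dim {:K})%N.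
Proof. by case/and3P: ord_c => irr_c /eqP/root_quartic rt _; apply: irreducible4_dim rt. Qed.

Let ev_inj := ev_inj spanb dimK.

Lemma integral_evP (x : K) : maximal_order x -> exists v, x = ev v.
Proof.
case/and3P: ord_c => _ _ max_c.
exact: (maximal_checkP evM spanb dimK int1 int2 int3 max_c).
Qed.

Lemma eps_inv : ev (eps c) * ev (epsi c) = 1.
Proof. by case/and3P: check_c => _ /and5P[/eqP E _ _ _ _] _; rewrite -evM E ev1. Qed.

Lemma eps_neq0 : ev (eps c) != 0.
Proof.
by apply: contra_eq_neq eps_inv => ->; rewrite mul0r eq_sym oner_eq0.
Qed.

Lemma rts_torsion (u : vec) : u \in rts c -> ev u ^+ 60 = 1.
Proof.
case/and3P: check_c => _ /and5P[_ _ _ /allP tors _] _ /tors/eqP E.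
by rewrite -ev_pow E ev1.
Qed.

(** If [eps] were a root of unity, all its powers would have trace at most 4 in absolute value. *)
Lemma eps_free (n : nat) : ev (eps c) ^+ n = 1 -> n = 0%N.
Proof.
case: n => // n en1; exfalso.
case/and3P: check_c => _ /and5P[_ _ _ _ /andP[/hasP[k _ /Z.ltb_lt trk] _]] _.
have /(trK_unity (basis_b spanb dimK) (ltn0Sn n)) : ev (vpow mul (eps c) k) ^+ n.+1 = 1.
  by rewrite ev_pow exprAC en1 expr1n.
rewrite (trK_ev evM spanb dimK) => tr_le.
have : (Z.abs (trv mul (vpow mul (eps c) k)) <= 4)%ZZ; last by lia.
move: (trv _ _) tr_le => z; rewrite /zin /= -intr_norm -[4%:R]/(4%:~R) ler_int.
by lia.
Qed.

Lemma eps_expr_inj : injective (fun n => ev (eps c) ^+ n).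
Proof.
have wlog_le m n : (m <= n)%N -> ev (eps c) ^+ m = ev (eps c) ^+ n -> m = n.
  move=> /subnKC <-; rewrite exprD -{1}[_ ^+ m]mulr1.
  by move/(mulfI (expf_neq0 _ eps_neq0))/esym/eps_free->; rewrite addn0.
by move=> m n /= E; case/orP: (leq_total m n) => [/wlog_le|/wlog_le/(_ (esym E))] //; apply.
Qed.

(** The 60th power removes the roots of unity and compares the exponents; the remaining equality is
    between members of a duplicate-free list. *)
Lemma rts_eps_inj (i i' j j' : nat) :
  (j < size (rts c))%N -> (j' < size (rts c))%N ->
  ev (nth v0 (rts c) j) * ev (eps c) ^+ i = ev (nth v0 (rts c) j') * ev (eps c) ^+ i' ->
  i = i' /\ j = j'.
Proof.
move=> ltj ltj' E.
have ii' : i = i'.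
  have := congr1 (fun x => x ^+ 60) E; rewrite !exprMn !rts_torsion ?mem_nth // !mul1r.
  by rewrite -!exprM => /eps_expr_inj/eqP; rewrite eqn_pmul2r // => /eqP.
split=> //; move: E; rewrite ii' => /mulIf -/(_ (expf_neq0 _ eps_neq0))/ev_inj/eqP.
by case/and3P: check_c => _ /and5P[_ uniq_u _ _ _] _; rewrite nth_uniq // => /eqP.
Qed.

Lemma unit_rts_eps (u : vec) (i n : nat) : u \in rts c ->
  unit_of (@maximal_order K) (ev (epsi c) ^+ n * (ev u * ev (eps c) ^+ i)).
Proof.
move=> urts.
have int_ev' v : maximal_order (ev v) := int_ev int1 int2 int3 v.
have intX v m : maximal_order (ev v ^+ m) by apply: integral_pow (int_ev' v).
have intM x y : maximal_order x -> maximal_order y -> maximal_order (x * y :> K).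
  exact: integral_mul.
split; first exact: intM (intX _ _) (intM _ _ (int_ev' _) (intX _ _)).
(* The inverse of [ev u] is its 59th power. *)
exists (ev (eps c) ^+ n * (ev u ^+ 59 * ev (epsi c) ^+ i)).
  exact: intM (intX _ _) (intM _ _ (intX _ _) (intX _ _)).
have -> : ev (epsi c) ^+ n * (ev u * ev (eps c) ^+ i) *
  (ev (eps c) ^+ n * (ev u ^+ 59 * ev (epsi c) ^+ i)) =
  (ev (eps c) * ev (epsi c)) ^+ n * (ev (eps c) * ev (epsi c)) ^+ i * ev u ^+ 60.
  by rewrite [ev u ^+ 60]exprS !exprMn; ring.
by rewrite eps_inv !expr1n rts_torsion // !mulr1.
Qed.

(** Starting from 0, each basis element, itself one of the units, is added as often as its
    coordinate says. *)
Lemma laurent_ev (v : vec) :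
  laurent b1 b2 b3 (digits (rts c) (hgt c)) (eps c) (epsi c) (ev v).
Proof.
case/and3P: check_c => _ /and5P[_ _ /allP usN _ /andP[_ /allP gen]].
case/andP=> ds0 /and3P[closr closl cent].
have add x i k : i \in iota 0 4 ->
  laurent b1 b2 b3 (digits (rts c) (hgt c)) (eps c) (epsi c) x ->
  laurent b1 b2 b3 (digits (rts c) (hgt c)) (eps c) (epsi c) (x + zin K k * ev (unitv i)).
  move=> /gen/hasP[u urts /hasP[m _ /eqP<-]]; rewrite evM ev_pow.
  exact: (laurent_addZ evM eps_inv ds0 closr closl cent usN k m urts).
have := add _ 3 v.2 isT (add _ 2 v.1.2 isT (add _ 1 v.1.1.2 isT
  (add _ 0 v.1.1.1 isT (laurent0 _ _ _ _ _ _)))).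
congr laurent; case: v => [[[a b] d] f].
by rewrite /vec_value /unitv /= !zinE; ring.
Qed.

Theorem field_checkP (x : K) :
  maximal_order x -> bounded_unit_sum (@maximal_order K) (hgt c) x.
Proof.
move=> /integral_evP[v ->].
have [n [s [sds ->]]] := laurent_word eps_inv (laurent_ev v).
have [cf [cf_le cfE]] : exists cf : nat -> nat -> nat, (forall i j, cf i j <= hgt c)%N /\
    word_value b1 b2 b3 (ev (eps c)) s = \sum_(i <- iota 0 (size s))
      \sum_(j <- iota 0 (size (rts c)))
        (ev (nth v0 (rts c) j) * ev (eps c) ^+ i) *+ cf i j.
  elim: s sds => [_|d s IHs sds]; first by exists (fun _ _ => 0%N); rewrite big_nil.
  have [|cf [cf_le cfE]] := IHs; first by move=> d' d's; apply: sds; rewrite inE d's orbT.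
  have [c0 [c0_le dE]] := digitsP b1 b2 b3 (sds d (mem_head _ _)).
  exists (fun i => if i is i'.+1 then cf i' else c0); split; first by case.
  have -> : iota 0 (size (d :: s)) = 0%N :: [seq j.+1 | j <- iota 0 (size s)].
    by rewrite -[LHS]/(0 :: iota (1 + 0) (size s)) iotaDl.
  rewrite big_cons big_map -[LHS]/(ev d + _ * word_value _ _ _ _ s) dE cfE mulr_sumr.
  congr (_ + _); first by apply: eq_bigr => j _; rewrite mulr1.
  apply: eq_bigr => i _; rewrite mulr_sumr; apply: eq_bigr => j _.
  by rewrite mulrnAr mulrCA exprS.
(* The common factor is absorbed into the units; being nonzero, it keeps them distinct. *)
pose f i j := ev (epsi c) ^+ n * (ev (nth v0 (rts c) j) * ev (eps c) ^+ i).
exists [seq (cf i j, f i j) | i <- iota 0 (size s), j <- iota 0 (size (rts c))].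
have unzip2E : unzip2 [seq (cf i j, f i j) | i <- iota 0 (size s), j <- iota 0 (size (rts c))]
    = [seq f i j | i <- iota 0 (size s), j <- iota 0 (size (rts c))].
  exact: map_allpairs.
split.
- rewrite unzip2E; apply: allpairs_uniq; rewrite ?iota_uniq // => -[i j] [i' j'] /=.
  move=> /allpairsP[[? ?] /= [_ + [_ ->]]]; rewrite mem_iota => ltj.
  move=> /allpairsP[[? ?] /= [_ + [_ ->]]]; rewrite mem_iota => ltj'.
  have epsi_neq0 : ev (epsi c) != 0.
    by apply: contra_eq_neq eps_inv => ->; rewrite mulr0 eq_sym oner_eq0.
  by move/(mulfI (expf_neq0 _ epsi_neq0))/(rts_eps_inj ltj ltj') => [-> ->].
- move=> e; rewrite unzip2E => /allpairsP[[i j] /= [_ + ->]]; rewrite mem_iota => ltj.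
  by apply/unit_rts_eps/mem_nth.
- by move=> a /mapP[p /allpairsP[[i j] [_ _ ->]] ->]; apply: cf_le.
rewrite big_allpairs_dep cfE mulr_sumr; apply: eq_bigr => i _.
by rewrite mulr_sumr; apply: eq_bigr => j _; rewrite mulrnAr.
Qed.

End Soundness.

(** * Orders given by two generators or one *)

(** A pair stands for [x.1 + x.2 z] with [z^2 = c1 z + c0]. *)
Definition mul2 (c0 c1 : Z) (x y : Z * Z) : Z * Z :=
  (x.1 * y.1 + x.2 * y.2 * c0, x.1 * y.2 + x.2 * y.1 + x.2 * y.2 * c1)%ZZ.

(** The basis is [1, z, d, z d], and [D] is the coefficient of [d^2 = t d - n]. *)
Definition mulT (c0 c1 : Z) (t n : Z * Z) (u v : vec) : vec :=
  let: (a, b, c, d) := u in let: (a', b', c', d') := v in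
  let A := mul2 c0 c1 (a, b) (a', b') in
  let B := mul2 c0 c1 (a, b) (c', d') in
  let C := mul2 c0 c1 (c, d) (a', b') in
  let D := mul2 c0 c1 (c, d) (c', d') in
  let E := mul2 c0 c1 D n in
  let F := mul2 c0 c1 D t in
  (A.1 - E.1, A.2 - E.2, B.1 + C.1 + F.1, B.2 + C.2 + F.2)%ZZ.

(** [r6], [r5], [r4] are the coefficients of the quotient of the product by the quartic [f], leading
    one first. *)
Definition mulP (f u v : vec) : vec :=
  let: (f0, f1, f2, f3) := f in
  let: (a, b, c, d) := u in let: (a', b', c', d') := v in
  let r6 := (d * d')%ZZ in
  let r5 := (c * d' + d * c' - r6 * f3)%ZZ in
  let r4 := (b * d' + c * c' + d * b' - r6 * f2 - r5 * f3)%ZZ in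
  (a * a' - r4 * f0,
   a * b' + b * a' - r4 * f1 - r5 * f0,
   a * c' + b * b' + c * a' - r4 * f2 - r5 * f1 - r6 * f0,
   a * d' + b * c' + c * b' + d * a' - r4 * f3 - r5 * f2 - r6 * f1)%ZZ.

Definition units4 : seq vec :=
  [:: (1, 0, 0, 0); (0, 1, 0, 0); (-1, 0, 0, 0); (0, -1, 0, 0)]%ZZ.
Definition units6 : seq vec :=
  [:: (1, 0, 0, 0); (1, 1, 0, 0); (0, 1, 0, 0);
      (-1, 0, 0, 0); (-1, -1, 0, 0); (0, -1, 0, 0)]%ZZ.
Definition units2 : seq vec := [:: (1, 0, 0, 0); (-1, 0, 0, 0)]%ZZ.

Section TowerRing.
Variables (K : fieldExtType rat) (c0 c1 : Z) (z d : K) (t n : Z * Z).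
Definition e2 (p : Z * Z) : K := zin K p.1 + zin K p.2 * z.

Hypothesis z2E : z ^+ 2 = zin K c1 * z + zin K c0.
Hypothesis d2E : d ^+ 2 = e2 t * d - e2 n.

Lemma e2M (p q : Z * Z) : e2 (mul2 c0 c1 p q) = e2 p * e2 q.
Proof.
case: p q => [p1 p2] [q1 q2]; rewrite /e2 /= !zinE.
have -> : (zin K p1 + zin K p2 * z) * (zin K q1 + zin K q2 * z) =
  zin K p1 * zin K q1 + (zin K p1 * zin K q2 + zin K p2 * zin K q1) * z
  + zin K p2 * zin K q2 * z ^+ 2 by ring.
by rewrite z2E; ring.
Qed.

Lemma ev_tower (u : vec) :
  vec_value z d (z * d) u = e2 (u.1.1.1, u.1.1.2) + e2 (u.1.2, u.2) * d.
Proof. by case: u => [[[? ?] ?] ?]; rewrite /vec_value /e2 /=; ring. Qed.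

Lemma tower_evM (u v : vec) :
  vec_value z d (z * d) (mulT c0 c1 t n u v) = vec_value z d (z * d) u * vec_value z d (z * d) v.
Proof.
rewrite !ev_tower; case: u v => [[[u1 u2] u3] u4] [[[v1 v2] v3] v4].
set A := e2 (u1, u2); set B := e2 (u3, u4).
set A' := e2 (v1, v2); set B' := e2 (v3, v4).
have -> : (A + B * d) * (A' + B' * d) = A * A' + (A * B' + B * A') * d + B * B' * d ^+ 2 by ring.
rewrite d2E /A /B /A' /B' -!e2M.
set X1 := mul2 _ _ _ _; set X2 := mul2 _ _ _ _; set X3 := mul2 _ _ _ _.
set X4 := mul2 _ _ _ _; rewrite /mulT -/X1 -/X2 -/X3 -/X4.
rewrite mulrBr mulrA -!e2M; move: (mul2 _ _ X4 t) (mul2 _ _ X4 n) => X5 X6.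
by rewrite /e2 /= !zinE; ring.
Qed.

Lemma integral_quadratic (x p q : K) :
  maximal_order p -> maximal_order q -> x ^+ 2 = p * x + q -> maximal_order x.
Proof.
move=> int_p int_q xE; apply: (@integral_root_monic _ _ _ _ (Poly [:: - q; - p; 1])).
- by rewrite monicE lead_coefE (PolyK (c := 0)) ?oner_eq0.
- by rewrite rootE horner_Poly /=; apply/eqP; ring: xE.
move=> y; rewrite (PolyK (c := 0)) ?oner_eq0 // !inE.
by case/or3P=> /eqP->; [exact: integral_opp|exact: integral_opp|exact: integral1].
Qed.

End TowerRing.

Lemma power_evM (K : fieldExtType rat) (x : K) (f : vec) :
  (let: (f0, f1, f2, f3) := f in
   x ^+ 4 + zin K f3 * x ^+ 3 + zin K f2 * x ^+ 2 + zin K f1 * x + zin K f0 = 0) ->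
  forall u v, vec_value x (x ^+ 2) (x ^+ 3) (mulP f u v) =
    vec_value x (x ^+ 2) (x ^+ 3) u * vec_value x (x ^+ 2) (x ^+ 3) v.
Proof.
case: f => [[[f0 f1] f2] f3] fx0 [[[a b] c] d] [[[a' b'] c'] d'].
rewrite /vec_value /mulP.
set r6 := (d * d')%ZZ; set r5 := (c * d' + d * c' - r6 * f3)%ZZ.
set r4 := (b * d' + c * c' + d * b' - r6 * f2 - r5 * f3)%ZZ.
(* Adding the quotient times the vanishing quartic turns the claim into a polynomial identity. *)
have -> : forall y w : K, y = w <-> w = y + (zin K r4 + zin K r5 * x + zin K r6 * x ^+ 2) *
  (x ^+ 4 + zin K f3 * x ^+ 3 + zin K f2 * x ^+ 2 + zin K f1 * x + zin K f0).
  by move=> y w; rewrite fx0 mulr0 addr0; split.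
by rewrite /r4 /r5 /r6 !zinE; ring.
Qed.

Lemma mem_span_ev (K : fieldExtType rat) (b1 b2 b3 x : K) (k : Z) (v : vec) :
  (k <> 0)%ZZ -> zin K k * x = vec_value b1 b2 b3 v -> x \in <<[:: 1%R; b1; b2; b3]>>%VS.
Proof.
move=> k_neq0 xE; set V := span _.
have mem y : y \in [:: 1; b1; b2; b3] -> y \in V by apply: memv_span.
have kx : zin rat k *: x \in V.
  rewrite -zin_scale xE ev_sum; apply: rpred_sum => i _; rewrite rpredZ // mem //.
  by rewrite mem_nth.
have zk_neq0 : zin rat k != 0 by rewrite -(zin0 rat) (inj_eq (@zin_inj rat)); apply/eqP.
suff -> : x = (zin rat k)^-1 *: (zin rat k *: x) by rewrite rpredZ.
by rewrite scalerA mulVf // scale1r.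
Qed.

(** The span contains 1 and is closed under products, by [evM] on the basis; so it contains the
    algebra generated by [ts]. *)
Lemma span_full (K : fieldExtType rat) (b1 b2 b3 : K) (mul : vec -> vec -> vec) (ts : seq K) :
  (forall u v, vec_value b1 b2 b3 (mul u v) = vec_value b1 b2 b3 u * vec_value b1 b2 b3 v) ->
  <<1 & ts>>%VS = fullv -> {subset ts <= <<[:: 1%R; b1; b2; b3]>>%VS} ->
  (fullv <= <<[:: 1%R; b1; b2; b3]>>)%VS.
Proof.
move=> evM <- ts_sub; set b := [tuple 1; b1; b2; b3]; set V := (X in (_ <= X)%VS).
have V1 : 1 \in V by apply: memv_span; rewrite inE eqxx.
have VV : (V * V <= V)%VS.
  apply/prodvP => x y /(@coord_span _ _ _ b) -> /(@coord_span _ _ _ b) ->.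
  rewrite mulr_suml; apply: rpred_sum => i _; rewrite mulr_sumr; apply: rpred_sum => j _.
  rewrite -scalerAl -scalerAr !rpredZ // -!ev_unitv -evM.
  by apply: (@mem_span_ev _ _ _ _ _ 1) => //; rewrite zin1 mul1r.
have V1' : (1 <= V)%VS by rewrite -memvE.
apply: agenv_sub_modl => //; apply: subv_trans VV; apply: prodvSl.
by rewrite subv_add V1' /=; apply/span_subvP.
Qed.

(* A quadratic extension of Q(z), z ^ 2 = c1 z + c0, generated by a square root x
   of [tsq], with ring of integers Z[z, d] where d ^ 2 = [ttr] d - [tnm] and
   [tden] (2 d - [ttr]) = [trt] x. *)
Record tower := Tower {
  tsq : Z * Z; ttr : Z * Z; tnm : Z * Z; trt : Z * Z; tden : Z; tcert : certificate }.

(** The conjugate of [z] is [c1 - z]. *)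
Definition tconj (c1 : Z) (p : Z * Z) : Z * Z := (p.1 + p.2 * c1, - p.2)%ZZ.

(** The first test is the square of the relation between [d] and [x]. [N] is the norm of [trt]; it
    is nonzero so that [x] can be recovered from [d]. *)
Definition tower_check (c0 c1 : Z) (T : tower) : bool :=
  let q2 := (tden T * tden T)%ZZ in
  let tt := mul2 c0 c1 (ttr T) (ttr T) in
  let N := mul2 c0 c1 (trt T) (tconj c1 (trt T)) in
  [&& mul2 c0 c1 (mul2 c0 c1 (trt T) (trt T)) (tsq T) ==
        (q2 * (tt.1 - 4 * (tnm T).1), q2 * (tt.2 - 4 * (tnm T).2))%ZZ,
      tden T != 0%ZZ, N.1 != 0%ZZ, N.2 == 0%ZZ &
      field_check (mulT c0 c1 (ttr T) (tnm T)) (tcert T)].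

(** * Fields with a certified tower or power basis *)

Section FieldLemmas.
Variable K : fieldExtType rat.

Lemma maximal_order_zin (k : Z) : maximal_order (zin K k).
Proof. exact: integral_id. Qed.

Lemma zin_neq0 (k : Z) : k != 0%ZZ -> zin K k != 0.
Proof. by rewrite -(zin0 K) (inj_eq (@zinK_inj K)). Qed.

Lemma e2_pair (z : K) (a b : Z) : e2 z (a, b) = zin K a + zin K b * z.
Proof. by []. Qed.

Lemma tower_basis_field (c0 c1 : Z) (z d : K) (t n : Z * Z) (c : certificate) (ts : seq K) :
  z ^+ 2 = zin K c1 * z + zin K c0 -> d ^+ 2 = e2 z t * d - e2 z n ->
  <<1 & ts>>%VS = fullv -> {subset ts <= <<[:: 1%R; z; d; (z * d)%R]>>%VS} ->
  field_check (mulT c0 c1 t n) c ->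
  forall y : K, maximal_order y -> bounded_unit_sum (@maximal_order K) (hgt c) y.
Proof.
move=> z2E d2E ts_full ts_sub chk.
have evM := tower_evM z2E d2E.
have int_z : maximal_order z.
  by apply: integral_quadratic z2E; apply: maximal_order_zin.
have int_e2 p : maximal_order (e2 z p).
  apply: integral_add; first exact: maximal_order_zin.
  by apply: integral_mul => //; apply: maximal_order_zin.
have int_d : maximal_order d.
  by apply: (integral_quadratic (int_e2 t) _ d2E); apply: integral_opp (int_e2 n).
apply: (field_checkP evM) chk => //; last exact: integral_mul.
exact: span_full evM ts_full ts_sub.
Qed.

Lemma tower_field (c0 c1 : Z) (T : tower) (z x : K) (ts : seq K) :
  tower_check c0 c1 T ->
  z ^+ 2 = zin K c1 * z + zin K c0 -> x ^+ 2 = e2 z (tsq T) ->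
  <<1 & ts>>%VS = fullv ->
  (forall V : {vspace K}, z \in V -> x \in V -> {subset ts <= V}) ->
  forall y : K, maximal_order y ->
    bounded_unit_sum (@maximal_order K) (hgt (tcert T)) y.
Proof.
case/and5P=> /eqP rootE q_neq0 N_neq0 /eqP N0 chk z2E x2E ts_full ts_sub.
pose q := zin K (tden T); have q0 : q != 0 by apply: zin_neq0.
have two0 : zin K 2%ZZ != 0 by apply: zin_neq0.
pose t := e2 z (ttr T); pose n := e2 z (tnm T); pose r := e2 z (trt T).
have twoE : zin K 2%ZZ = 2 by [].
have fourE : zin K 4%ZZ = 4 by [].
rewrite twoE in two0.
(* The quadratic formula for [d^2 = t d - n], with [r x / q] as square root of the discriminant. *)
pose d := (t + r * x / q) / 2.
have dE : q * (2 * d - t) = r * x by rewrite /d; field; rewrite two0.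
have rrE : r ^+ 2 * e2 z (tsq T) = q ^+ 2 * (t ^+ 2 - 4 * n).
  rewrite /r expr2 -!(e2M z2E) rootE [t ^+ 2]expr2 /t -(e2M z2E).
  move: (mul2 c0 c1 (ttr T) (ttr T)) => tt.
  by rewrite e2_pair !zinE fourE /q /n /e2; ring.
have d2E : d ^+ 2 = t * d - n.
  apply/eqP; rewrite -subr_eq0; apply/eqP.
  apply: (mulfI (x := 4 * q ^+ 2)).
    by rewrite mulf_neq0 ?expf_neq0 // (_ : 4 = 2 * 2) ?mulf_neq0 // -natrM.
  have -> : 4 * q ^+ 2 * (d ^+ 2 - (t * d - n)) =
    (q * (2 * d - t)) ^+ 2 - q ^+ 2 * (t ^+ 2 - 4 * n) by ring.
  by rewrite dE exprMn x2E rrE subrr mulr0.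
apply: (tower_basis_field z2E d2E ts_full _ chk); apply: ts_sub.
  by apply: memv_span; rewrite !inE eqxx orbT.
(* Multiplying [q (2 d - t) = r x] by the conjugate [s] of [r] makes the coefficient of [x] an
   integer, the norm of [r]. *)
pose s := tconj c1 (trt T).
have srE : e2 z s * r = zin K (mul2 c0 c1 (trt T) s).1.
  by rewrite mulrC -(e2M z2E) /e2 N0 zin0 mul0r addr0.
pose st := mul2 c0 c1 s (ttr T).
apply: (@mem_span_ev K _ _ _ _ _ (- tden T * st.1, - tden T * st.2,
  2 * tden T * s.1, 2 * tden T * s.2)%ZZ (elimN eqP N_neq0)).
rewrite -srE -mulrA -dE ev_tower /=.
have -> : e2 z (- tden T * st.1, - tden T * st.2)%ZZ = - q * e2 z st.
  by move: st => st'; rewrite e2_pair !zinE /q /e2; ring.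
have -> : e2 z (2 * tden T * s.1, 2 * tden T * s.2)%ZZ = 2 * q * e2 z s.
  by move: s {srE st} => s'; rewrite e2_pair !zinE twoE /q /e2; ring.
by rewrite /st (e2M z2E) -/t; ring.
Qed.

Lemma tower_table_field (c0 c1 : Z) (Ts : seq tower) (a : Z * Z) (w : nat) (z x : K)
    (ts : seq K) :
  all (tower_check c0 c1) Ts ->
  has (fun T => (tsq T == a) && (hgt (tcert T) == w)) Ts ->
  z ^+ 2 = zin K c1 * z + zin K c0 -> x ^+ 2 = e2 z a ->
  <<1 & ts>>%VS = fullv ->
  (forall V : {vspace K}, z \in V -> x \in V -> {subset ts <= V}) ->
  forall y : K, maximal_order y -> bounded_unit_sum (@maximal_order K) w y.
Proof.
elim: Ts => //= T Ts IHTs /andP[chkT chkTs] /orP[/andP[/eqP<- /eqP<-]|].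
  exact: tower_field chkT.
exact: IHTs.
Qed.

Lemma power_field (f : vec) (x : K) (c : certificate) (ts : seq K) :
  (let: (f0, f1, f2, f3) := f in
   x ^+ 4 + zin K f3 * x ^+ 3 + zin K f2 * x ^+ 2 + zin K f1 * x + zin K f0 = 0) ->
  <<1 & ts>>%VS = fullv ->
  (forall y, y \in ts -> exists v, y = vec_value x (x ^+ 2) (x ^+ 3) v) ->
  field_check (mulP f) c ->
  forall y : K, maximal_order y -> bounded_unit_sum (@maximal_order K) (hgt c) y.
Proof.
move=> fx0 ts_full ts_ev chk; have evM := power_evM fx0.
have int_x : maximal_order x.
  case: f fx0 {evM chk} => [[[f0 f1] f2] f3] fx0.
  apply: (@integral_root_monic _ _ _ _ (Poly [:: zin K f0; zin K f1; zin K f2; zin K f3; 1])).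
  - by rewrite monicE lead_coefE (PolyK (c := 0)) ?oner_eq0.
  - by apply/rootP; rewrite horner_Poly /= -[RHS]fx0; ring.
  move=> y; rewrite (PolyK (c := 0)) ?oner_eq0 // !inE.
  by do ?[case/orP]; move=> /eqP->; (exact: maximal_order_zin || exact: integral1).
apply: (field_checkP evM) chk => //; try exact: integral_pow.
apply: (span_full evM ts_full) => y /ts_ev[v ->].
by apply: (@mem_span_ev _ _ _ _ _ 1) => //; rewrite zin1 mul1r.
Qed.

End FieldLemmas.

(** * Certificates of the listed fields *)

Definition vdelta : vec := (0, 0, 1, 0)%ZZ.

(** The unit of infinite order is the generator [d] of the tower. *)
Definition tower_cert (us : seq vec) (w : nat) (prim minp : vec) (sqp : seq Z) (epsi : vec)
    (carr carl : seq vec) : certificate :=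
  Certificate prim minp sqp vdelta epsi us w carr carl.

(** Here [z^2 = -1]. The entries [(0, 1)] and [(3, 0)] serve the cyclotomic fields of orders 8 and
    12. For [(5, 0)], [d^2 = d + 1], so [z + d] is taken as primitive element. *)
Definition gauss_towers : seq tower :=
  [:: Tower (0, 1) (2, 2) (0, 1) (2, 0) 1
      (tower_cert units4 1 (0, 0, 1, 0) (1, -4, 8, -4) [:: 2; 2; 2; 2] (2, -2, 0, 1)
        [:: (1, 0, 0, 0); (2, -2, 0, 1); (2, -1, 0, 1); (1, -2, 0, 1); (1, -1, 0, 1);
            (3, 0, -1, 1)]
        [:: (1, 0, 0, 0); (0, 0, 1, 0); (-1, 0, 1, 0); (0, -1, 1, 0); (-1, -1, 1, 0);
            (0, -1, 1, 1)]);
      Tower (3, 0) (2, -1) (0, -1) (1, 0) 1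
      (tower_cert units4 1 (0, 0, 1, 0) (1, -2, 5, -4) [:: 2; 2; 3] (1, 2, 0, -1)
        [:: (1, 0, 0, 0); (1, 1, 0, 0); (1, 1, 0, -1); (0, 1, 0, -1); (-1, 2, 1, -1);
            (0, 2, 1, -1); (0, 1, 1, -1)]
        [:: (1, 0, 0, 0); (0, 0, 1, 0); (0, 1, 1, 0); (-1, 0, 1, 0); (-1, 1, 1, 0);
            (-1, 0, 1, 1); (-1, -1, 1, 1); (-2, -1, 1, 1)]);
      Tower (1, 1) (2, 0) (0, -1) (2, 0) 1
      (tower_cert units4 1 (0, 0, 1, 0) (1, 0, 4, -4) [:: 2; 2; 2; 2] (0, 2, 0, -1)
        [:: (1, 0, 0, 0); (1, 1, 0, 0); (0, 2, 0, -1); (0, 1, 0, -1); (1, 1, 0, -1);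
            (-1, 1, 0, -1); (-1, 1, 1, -1)]
        [:: (1, 0, 0, 0); (1, 1, 0, 0); (0, 0, 1, 0); (0, 1, 1, 0); (-1, 0, 1, 0);
            (-1, 1, 1, 0); (0, 0, 1, 1)]);
      Tower (1, 2) (1, 1) (1, 0) (1, 1) 1
      (tower_cert units4 1 (0, 0, 1, 0) (1, -2, 4, -2) [:: 2; 2; 2] (1, 1, -1, 0)
        [:: (1, 0, 0, 0); (0, 1, -1, 0); (1, 0, -1, 0)]
        [:: (1, 0, 0, 0); (0, 0, 1, 0); (-1, 0, 1, 0)]);
      Tower (1, 4) (1, 0) (0, -1) (1, 0) 1
      (tower_cert units4 1 (0, 0, 1, 0) (1, 0, 1, -2) [:: 2; 2] (0, 1, 0, -1)
        [:: (1, 0, 0, 0); (1, 1, 0, 0); (0, 0, 0, -1); (1, 0, 0, -1); (-1, 1, 1, -1);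
            (0, 1, 1, -1); (0, 0, 1, -1)]
        [:: (1, 0, 0, 0); (-1, 0, 1, 0); (0, -1, 1, 0); (-1, 1, 1, 0); (-1, -1, 1, 0);
            (-1, 0, 1, 1)]);
      Tower (7, 4) (2, 1) (-1, 0) (1, 0) 1
      (tower_cert units4 2 (0, 0, 1, 0) (1, 4, 3, -4) [:: 2; 2] (-2, -1, 1, 0)
        [:: (1, 0, 0, 0); (-1, -1, 1, 0); (-2, 0, 1, 0)]
        [:: (1, 0, 0, 0); (-1, 0, 1, 0); (0, -1, 1, 0)]);
      Tower (5, 0) (1, 0) (-1, 0) (1, 0) 1
      (tower_cert units4 1 (0, 1, 1, 0) (5, 0, 1, -2) [:: 2; 2; 5] (-1, 0, 1, 0)
        [:: (1, 0, 0, 0); (0, 0, 1, 0)]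
        [:: (1, 0, 0, 0); (-1, 0, 1, 0)])]%ZZ.

(** Here [z] is a primitive cube root of unity. For 6 and 21, up to signs of the roots, [d] is
    [sqrt(-3) + sqrt(-2)] and half of [sqrt(-3) + sqrt(-7)]; dividing by [sqrt(-3)] causes the
    denominator 3. *)
Definition eisenstein_towers : seq tower :=
  [:: Tower (2, 1) (2, 2) (1, 0) (2, 2) 1
      (tower_cert units6 1 (0, 0, 1, 0) (1, -2, 6, -2) [:: 2; 2; 3] (2, 2, -1, 0)
        [:: (1, 0, 0, 0); (1, 1, -1, 0); (2, 1, -1, 0)]
        [:: (1, 0, 0, 0); (-1, -1, 1, 0); (0, -1, 1, 0)]);
      Tower (4, 1) (1, 1) (-1, 0) (1, 0) 1
      (tower_cert units6 1 (0, 0, 1, 0) (1, 1, -1, -1) [:: 3] (-1, -1, 1, 0)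
        [:: (1, 0, 0, 0); (0, -1, 1, 0); (0, 0, 1, 0)]
        [:: (1, 0, 0, 0); (-1, 0, 1, 0); (-1, -1, 1, 0)]);
      Tower (8, 1) (1, -2) (1, 0) (0, 1) 1
      (tower_cert units6 1 (0, 0, 1, 0) (1, -4, 9, -4) [:: 3] (1, -2, -1, 0)
        [:: (1, 0, 0, 0); (1, -1, -1, 0); (0, -2, -1, 0)]
        [:: (1, 0, 0, 0); (0, 1, 1, 0); (-1, 0, 1, 0)]);
      Tower (3, 2) (2, -2) (1, 0) (0, 2) 1
      (tower_cert units6 1 (0, 0, 1, 0) (1, -6, 14, -6) [:: 2; 2; 3] (2, -2, -1, 0)
        [:: (1, 0, 0, 0); (2, -1, -1, 0); (1, -2, -1, 0)]
        [:: (1, 0, 0, 0); (0, 1, 1, 0); (-1, 0, 1, 0)]);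
      Tower (4, 3) (4, 2) (-1, 0) (2, 0) 1
      (tower_cert units6 1 (0, 0, 1, 0) (1, 6, 10, -6) [:: 2; 2; 3] (-4, -2, 1, 0)
        [:: (1, 0, 0, 0); (-3, -2, 1, 0); (-3, -1, 1, 0)]
        [:: (1, 0, 0, 0); (0, 0, 1, 0); (1, 1, 1, 0); (-1, -1, 1, 0); (0, -1, 1, 0)]);
      Tower (7, 3) (2, 1) (-1, 0) (1, 0) 1
      (tower_cert units6 1 (0, 0, 1, 0) (1, 3, 1, -3) [:: 3] (-2, -1, 1, 0)
        [:: (1, 0, 0, 0); (-1, -1, 1, 0); (-1, 0, 1, 0)]
        [:: (1, 0, 0, 0); (-1, 0, 1, 0); (-1, -1, 1, 0)]);
      Tower (11, 3) (3, 4) (-1, 0) (1, 1) 1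
      (tower_cert units6 1 (0, 0, 1, 0) (1, 2, 11, -2) [:: 3] (-3, -4, 1, 0)
        [:: (1, 0, 0, 0); (-2, -3, 1, 0); (-3, -3, 1, 0)]
        [:: (1, 0, 0, 0); (-1, -1, 1, 0); (0, -1, 1, 0)]);
      Tower (5, 4) (1, 1) (1, 0) (1, 1) 1
      (tower_cert units6 1 (0, 0, 1, 0) (1, -1, 3, -1) [:: 3] (1, 1, -1, 0)
        [:: (1, 0, 0, 0); (0, 0, -1, 0); (1, 0, -1, 0)]
        [:: (1, 0, 0, 0); (-1, -1, 1, 0); (0, -1, 1, 0)]);
      Tower (9, 4) (0, 3) (-1, 0) (0, 1) 1
      (tower_cert units6 1 (0, 0, 1, 0) (1, -3, 7, 3) [:: 3] (0, -3, 1, 0)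
        [:: (1, 0, 0, 0); (0, -2, 1, 0); (-1, -3, 1, 0)]
        [:: (1, 0, 0, 0); (1, 0, 1, 0); (0, -1, 1, 0)]);
      Tower (13, 4) (3, 3) (1, 0) (1, 1) 1
      (tower_cert units6 1 (0, 0, 1, 0) (1, -3, 11, -3) [:: 3] (3, 3, -1, 0)
        [:: (1, 0, 0, 0); (3, 3, -1, 0); (2, 2, -1, 0)]
        [:: (1, 0, 0, 0); (0, 0, 1, 0); (-1, -1, 1, 0)]);
      Tower (12, 5) (3, 1) (-1, 0) (1, 0) 1
      (tower_cert units6 1 (0, 0, 1, 0) (1, 5, 5, -5) [:: 3] (-3, -1, 1, 0)
        [:: (1, 0, 0, 0); (-2, -1, 1, 0); (-2, 0, 1, 0); (-3, 0, 1, 0)]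
        [:: (1, 0, 0, 0); (0, 0, 1, 0); (-1, 0, 1, 0); (-1, -1, 1, 0)]);
      Tower (11, 7) (4, 1) (1, 0) (1, 0) 1
      (tower_cert units6 1 (0, 0, 1, 0) (1, -7, 15, -7) [:: 3] (4, 1, -1, 0)
        [:: (1, 0, 0, 0); (3, 1, -1, 0); (3, 0, -1, 0)]
        [:: (1, 0, 0, 0); (-1, 0, 1, 0); (-1, -1, 1, 0)]);
      Tower (9, 8) (3, 2) (-1, 0) (1, 0) 1
      (tower_cert units6 1 (0, 0, 1, 0) (1, 4, 5, -4) [:: 3] (-3, -2, 1, 0)
        [:: (1, 0, 0, 0); (-2, -2, 1, 0); (-2, -1, 1, 0)]
        [:: (1, 0, 0, 0); (-1, 0, 1, 0); (-1, -1, 1, 0)]);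
      Tower (15, 11) (1, -3) (-1, 0) (0, 1) 1
      (tower_cert units6 1 (0, 0, 1, 0) (1, 5, 11, -5) [:: 3] (-1, 3, 1, 0)
        [:: (1, 0, 0, 0); (0, 3, 1, 0); (-1, 2, 1, 0)]
        [:: (1, 0, 0, 0); (0, 0, 1, 0); (1, 1, 1, 0); (0, 1, 1, 0)]);
      Tower (19, 11) (3, 4) (1, 0) (1, 1) 1
      (tower_cert units6 2 (0, 0, 1, 0) (1, -2, 15, -2) [:: 3] (3, 4, -1, 0)
        [:: (1, 0, 0, 0); (2, 3, -1, 0); (3, 3, -1, 0)]
        [:: (1, 0, 0, 0); (-1, -1, 1, 0); (0, -1, 1, 0)]);
      Tower (17, 12) (3, 5) (-1, 0) (1, 1) 1
      (tower_cert units6 2 (0, 0, 1, 0) (1, 1, 17, -1) [:: 3] (-3, -5, 1, 0)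
        [:: (1, 0, 0, 0); (-2, -4, 1, 0); (-3, -4, 1, 0)]
        [:: (1, 0, 0, 0); (-1, -1, 1, 0); (0, -1, 1, 0)]);
      Tower (17, 16) (5, 2) (1, 0) (1, 0) 1
      (tower_cert units6 2 (0, 0, 1, 0) (1, -8, 21, -8) [:: 3] (5, 2, -1, 0)
        [:: (1, 0, 0, 0); (4, 2, -1, 0); (4, 1, -1, 0)]
        [:: (1, 0, 0, 0); (-1, 0, 1, 0); (-1, -1, 1, 0)]);
      Tower (5, 0) (1, 0) (-1, 0) (1, 0) 1
      (tower_cert units6 1 (0, 1, 1, 0) (4, 0, -1, 0) [:: 3; 5] (-1, 0, 1, 0)
        [:: (1, 0, 0, 0); (0, 0, 1, 0)]
        [:: (1, 0, 0, 0); (-1, 0, 1, 0)]);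
      Tower (6, 0) (2, 4) (-1, 0) (2, 4) 3
      (tower_cert units6 1 (0, 0, 1, 0) (1, 0, 10, 0) [:: 2; 2; 2; 3] (-2, -4, 1, 0)
        [:: (1, 0, 0, 0); (-1, -3, 1, 0); (-2, -3, 1, 0); (-1, -2, 1, 0)]
        [:: (1, 0, 0, 0); (-1, -1, 1, 0); (0, -1, 1, 0); (-1, -2, 1, 0)]);
      Tower (21, 0) (1, 2) (1, 0) (1, 2) 3
      (tower_cert units6 1 (0, 0, 1, 0) (1, 0, 5, 0) [:: 3; 7] (1, 2, -1, 0)
        [:: (1, 0, 0, 0); (1, 2, -1, 0)]
        [:: (1, 0, 0, 0); (0, 0, 1, 0)])]%ZZ.

Lemma gauss_towers_ok : all (tower_check (-1) 0) gauss_towers.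
Proof. vm_cast_no_check (erefl true). Qed.

Lemma eisenstein_towers_ok : all (tower_check (-1) (-1)) eisenstein_towers.
Proof. vm_cast_no_check (erefl true). Qed.

Definition quartic1_cert : certificate :=
  Certificate (0, 1, 0, 0) (1, -1, 0, 0) [::] (0, 1, 0, 0) (1, 0, 0, -1) units2 1
    [:: (1, 0, 0, 0); (0, 1, 0, 0); (1, 1, 0, 0); (0, 0, 1, 0); (1, 0, 1, 0); (-1, 0, 1, 0);
        (0, 1, 1, 0); (-1, 0, 0, 1); (-1, 1, 0, 1); (0, 1, 0, 1); (-1, -1, 0, 1); (0, 0, 1, 1)]
    [:: (1, 0, 0, 0); (1, 0, 0, -1); (-1, 0, 0, -1); (0, 0, -1, 0); (1, 0, -1, 0);
        (-1, 0, -1, 0); (0, 0, -1, -1); (-1, 0, -1, 1); (0, -1, 0, 0); (1, -1, 0, 0);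
        (-1, -1, 0, 0); (0, -1, 0, -1); (1, -1, 0, -1); (0, -1, 0, 1); (0, -1, -1, 0);
        (1, -1, -1, 0); (-1, -1, -1, 0); (0, -1, -1, -1); (1, -1, -1, -1); (-1, -1, 1, 1)]%ZZ.

Lemma quartic1_ok : field_check (mulP (1, -1, 0, 0)%ZZ) quartic1_cert.
Proof. vm_cast_no_check (erefl true). Qed.

Definition quartic2_cert : certificate :=
  Certificate (0, 1, 0, 0) (1, -1, 1, 0) [::] (0, 1, 0, 0) (1, -1, 0, -1) units2 1
    [:: (1, 0, 0, 0); (0, 1, 0, 0); (1, 1, 0, 0); (1, 0, 1, 0); (2, 0, 1, 0); (0, 0, 1, 0);
        (0, 1, 1, 0); (0, 1, 0, 1); (0, 2, 0, 1); (-1, 0, 0, 1); (0, 0, 1, 1); (-1, 0, 1, 1);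
        (-1, 1, -1, 1); (-1, 0, -1, 1)]
    [:: (1, 0, 0, 0); (0, -1, 0, -1); (1, -1, 0, -1); (0, 0, -1, 0); (-1, 0, -1, 0);
        (0, -1, -1, -1); (1, -1, -1, -1); (-1, -1, -1, -1); (0, -1, 0, 0); (-1, -1, 0, 0);
        (0, 0, 0, 1); (-1, 0, 0, 1); (0, -1, -1, 0); (-1, -1, -1, 0); (0, -2, -1, -1)]%ZZ.

Lemma quartic2_ok : field_check (mulP (1, -1, 1, 0)%ZZ) quartic2_cert.
Proof. vm_cast_no_check (erefl true). Qed.

Definition quartic3_cert : certificate :=
  Certificate (0, 1, 0, 0) (1, -2, 2, 0) [:: 2; 2] (0, 1, 0, 0) (2, -2, 0, -1) units2 2
    [:: (1, 0, 0, 0); (0, 1, 0, 0); (1, 1, 0, 0); (2, 0, 1, 0); (1, 0, 1, 0); (2, 1, 1, 0);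
        (-2, 2, 0, 1); (-1, 2, 0, 1); (-3, 2, 0, 1); (0, 2, 1, 1); (-1, 2, 1, 1)]
    [:: (1, 0, 0, 0); (0, -2, 0, -1); (1, -2, 0, -1); (0, 0, -1, 0); (-1, 0, -1, 0);
        (0, -2, -1, -1); (1, -2, -1, -1); (1, -1, 0, 0); (-1, -1, 0, 0); (-1, 1, 0, 1);
        (0, -1, -1, 0); (-1, -1, -1, 0); (0, -3, -1, -1)]%ZZ.

Lemma quartic3_ok : field_check (mulP (1, -2, 2, 0)%ZZ) quartic3_cert.
Proof. vm_cast_no_check (erefl true). Qed.

(** The listed polynomial [X^4 - X^3 + 2X^2 - X + 2] has roots of norm 2, which are not units; a
    unit with another minimal polynomial generates the same field. *)
Definition quartic4_cert : certificate :=
  Certificate (0, 1, 0, 0) (1, -1, 3, 0) [::] (0, 1, 0, 0) (1, -3, 0, -1) units2 2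
    [:: (1, 0, 0, 0); (0, 1, 0, 0); (1, 1, 0, 0); (2, 0, 1, 0); (2, 1, 1, 0); (3, -1, 1, 0);
        (-1, 2, 0, 1); (0, 2, 0, 1); (-2, 2, 0, 1); (2, 2, 1, 1); (-3, 3, -1, 1)]
    [:: (1, 0, 0, 0); (0, -3, 0, -1); (1, -3, 0, -1); (-1, -3, 0, -1); (-1, 0, -1, 0);
        (0, -3, -1, -1); (0, -1, 0, 0); (-1, -1, 0, 0); (0, 2, 0, 1); (1, 2, 0, 1);
        (-1, 2, 0, 1); (0, -1, -1, 0); (-1, -1, -1, 0)]%ZZ.

Lemma quartic4_ok : field_check (mulP (1, -1, 3, 0)%ZZ) quartic4_cert.
Proof. vm_cast_no_check (erefl true). Qed.

Definition quartic5_cert : certificate :=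
  Certificate (0, 1, 0, 0) (1, 1, 0, -1) [:: 2; 7] (0, 1, 0, 0) (-1, 0, 1, -1) units2 3
    [:: (1, 0, 0, 0); (-1, 1, 0, 0); (0, 1, 0, 0); (-2, 1, 0, 0); (0, -1, 1, 0); (-1, 0, 1, 0);
        (0, 0, 1, 0); (1, -2, 1, 0); (0, 0, -1, 1); (1, 1, -1, 1); (-1, 1, -1, 1);
        (1, -1, 0, 1); (2, -1, 0, 1); (0, 0, 0, 1); (0, 1, -2, 1)]
    [:: (1, 0, 0, 0); (-1, 0, 1, -1); (1, 1, -1, 0); (-1, 1, -1, 0); (0, 1, 0, -1);
        (0, 1, -2, 1); (1, 1, -2, 1); (1, -1, 0, 0); (0, -1, 1, -1); (1, -1, 1, -1);
        (-1, -1, 1, -1); (0, -1, -1, 1); (1, 0, -1, 0); (0, -2, 1, 0); (1, -2, 1, 0);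
        (-1, -2, 1, 0); (0, -2, 2, -1)]%ZZ.

Lemma quartic5_ok : field_check (mulP (1, 1, 0, -1)%ZZ) quartic5_cert.
Proof. vm_cast_no_check (erefl true). Qed.

Definition quartic6_cert : certificate :=
  Certificate (0, 1, 0, 0) (1, 1, 1, -1) [:: 11] (0, 1, 0, 0) (-1, -1, 1, -1) units2 3
    [:: (1, 0, 0, 0); (-1, 1, 0, 0); (0, 1, 0, 0); (1, -1, 1, 0); (0, -1, 1, 0); (1, 0, 1, 0);
        (-1, 0, 1, 0); (0, 1, -1, 1); (1, 0, -1, 1); (2, 0, 0, 1); (1, 0, 0, 1); (1, 1, 0, 1);
        (0, 1, 0, 1); (2, -1, 0, 1); (1, 1, -2, 1)]
    [:: (1, 0, 0, 0); (0, -1, 1, -1); (-1, -1, 1, -1); (0, 1, -1, 0); (-1, 1, -1, 0);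
        (1, 2, -2, 1); (-1, 2, -2, 1); (1, -1, 0, 0); (1, 0, -1, 1); (0, 1, -2, 1);
        (0, -2, 1, 0); (1, -2, 1, 0); (0, -3, 2, -1); (1, -3, 2, -1); (1, -1, 0, 1)]%ZZ.

Lemma quartic6_ok : field_check (mulP (1, 1, 1, -1)%ZZ) quartic6_cert.
Proof. vm_cast_no_check (erefl true). Qed.

Definition silver_cert : certificate :=
  Certificate (0, 1, 0, 0) (-1, 0, 2, 0) [:: 2; 2; 2; 2; 2] (0, 1, 0, 0) (0, 2, 0, 1) units2 1
    [:: (1, 0, 0, 0); (0, 1, 0, 0); (2, 0, 1, 0); (0, 2, 0, 1)]
    [:: (-1, 0, 0, 0); (0, -2, 0, -1); (-1, 0, -1, 0); (0, -3, 0, -1)]%ZZ.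

Lemma silver_ok : field_check (mulP (-1, 0, 2, 0)%ZZ) silver_cert.
Proof. vm_cast_no_check (erefl true). Qed.

Definition golden_cert : certificate :=
  Certificate (0, 1, 0, 0) (-1, 0, 1, 0) [:: 2; 2; 5] (0, 1, 0, 0) (0, 1, 0, 1) units2 1
    [:: (1, 0, 0, 0); (0, 1, 0, 0); (1, 0, 1, 0); (0, 1, 0, 1)]
    [:: (-1, 0, 0, 0); (0, -1, 0, -1); (-1, -1, 0, -1); (-1, 0, -1, 0); (0, 1, -1, 1);
        (-1, 1, -1, 1); (0, -2, 0, -1)]%ZZ.

Lemma golden_ok : field_check (mulP (-1, 0, 1, 0)%ZZ) golden_cert.
Proof. vm_cast_no_check (erefl true). Qed.

(** A tower over the real quadratic subfield: the unit of infinite order is [z] with [z^2 = z + 1],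
    and [d] is the fifth root of unity, with [d^2 = (z - 1) d - 1]. *)
Definition zeta5_cert : certificate :=
  Certificate (0, 0, 1, 0) (1, 1, 1, 1) [:: 5] (0, 1, 0, 0) (-1, 1, 0, 0)
    [:: (1, 0, 0, 0); (-1, 0, 0, 0); (0, 0, 1, 0); (0, 0, -1, 0)] 1
    [:: (0, 0, 1, 0); (1, 0, 1, 0); (1, 0, -1, 0); (1, 0, -2, 1); (-1, 1, 0, 0);
        (-1, 1, -1, 0); (-2, 1, 0, 0); (-2, 1, 1, 0); (-2, 1, -1, 0); (-1, 1, -1, 1);
        (-2, 1, 0, 1); (-2, 1, -2, 1)]
    [:: (0, 0, 1, 0); (1, 0, 1, 0); (1, 0, -1, 0); (0, 0, 0, 1); (0, 0, 1, 1); (0, 1, 0, 0);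
        (-1, 1, 0, 0); (-1, 1, -1, 0)]%ZZ.

Lemma zeta5_ok : field_check (mulT 1 1 (-1, 1)%ZZ (1, 0)%ZZ) zeta5_cert.
Proof. vm_cast_no_check (erefl true). Qed.

Definition mark_height (m : mark) : nat :=
  match m with Unmarked => 1 | Dagger => 2 | DoubleDagger => 3 end.

Definition in_towers (Ts : seq tower) (w : nat) (ab : nat * nat) : bool :=
  has (fun T => (tsq T == (Z.of_nat ab.1, Z.of_nat ab.2)) && (hgt (tcert T) == w)) Ts.

(** * From the listed generators to the certificates *)

Section Listed.
Variables (K : fieldExtType rat) (iota : {rmorphism K -> algC}).
Local Notation bounded w :=
  (forall y : K, maximal_order y -> bounded_unit_sum (@maximal_order K) w y).

Lemma prim3_eq (z : K) : 3.-primitive_root z -> z ^+ 2 = zin K (-1)%ZZ * z + zin K (-1)%ZZ.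
Proof.
move=> prim_z; have z3 := prim_expr_order prim_z.
have z1 : z - 1 != 0 by rewrite subr_eq0 -[z]expr1 -(prim_order_dvd prim_z).
apply: (mulfI z1); rewrite zinN1.
have -> : (z - 1) * z ^+ 2 = z ^+ 3 - z ^+ 2 by ring.
by rewrite z3; ring.
Qed.

Lemma imaginary_eq (z : K) : iota z = 'i -> z ^+ 2 = zin K 0%ZZ * z + zin K (-1)%ZZ.
Proof.
move=> zi; apply: (fmorph_inj iota).
by rewrite rmorphXn zi sqrCi zinN1 zin0 mul0r add0r rmorphN1.
Qed.

(** As [b] is nonzero, [(x^2 - a) / b] is the required element of [K]. *)
Lemma sqrt_generator (x : K) (a b : nat) (z : algC) :
  (0 < b)%N -> iota x = sqrtC (a%:R + b%:R * z) ->
  exists z' : K, iota z' = z /\ x ^+ 2 = e2 z' (Z.of_nat a, Z.of_nat b).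
Proof.
move=> b_gt0 xE.
have b0 : zin K (Z.of_nat b) != 0 by apply: zin_neq0; apply/eqP; lia.
rewrite zin_nat in b0.
exists ((x ^+ 2 - a%:R) / b%:R); split; last first.
  by rewrite e2_pair !zin_nat; field.
rewrite fmorph_div rmorphB rmorphXn !rmorph_nat xE sqrtCK.
by field; rewrite -(rmorph_nat iota) fmorph_eq0.
Qed.

Lemma root_of_unity_field (mu : nat) (x : K) :
  mu \in [:: 5; 8; 12]%N -> mu.-primitive_root x -> <<1 & [:: x]>>%VS = fullv -> bounded 1%N.
Proof.
move=> + prim_x full; have xmu := prim_expr_order prim_x.
have xn k : ~~ (mu %| k)%N -> x ^+ k - 1 != 0 by rewrite subr_eq0 -(prim_order_dvd prim_x).
rewrite !inE => /or3P[] /eqP muE; rewrite {mu}muE in xmu xn prim_x.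
- have x4 : x ^+ 4 = - (1 + x + x ^+ 2 + x ^+ 3).
    apply: (mulfI (xn 1%N isT)); rewrite expr1.
    have -> : (x - 1) * x ^+ 4 = x ^+ 5 - x ^+ 4 by ring.
    by rewrite xmu; ring.
  (* [-(x^2 + x^3)] satisfies [z^2 = z + 1], and [x + x^-1 = z - 1]. *)
  apply: (@tower_basis_field K 1 1 (- (x ^+ 2 + x ^+ 3)) x _ _ zeta5_cert
    [:: x] _ _ full _ zeta5_ok).
  + by rewrite !zinE; ring: x4.
  + by rewrite !e2_pair !zinE; ring: x4.
  by move=> y; rewrite inE => /eqP->; apply: memv_span; rewrite !inE eqxx !orbT.
- have x4 : x ^+ 4 = -1.
    apply: (mulfI (xn 4%N isT)).
    have -> : (x ^+ 4 - 1) * x ^+ 4 = x ^+ 8 - x ^+ 4 by ring.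
    by rewrite xmu; ring.
  apply: (@tower_table_field K _ _ _ (0, 1)%ZZ 1 (x ^+ 2) x _ gauss_towers_ok) full _ => //.
  + by rewrite !zinE; ring: x4.
  + by rewrite e2_pair !zinE; ring.
  by move=> V _ xV y; rewrite inE => /eqP->.
have x6 : x ^+ 6 = -1.
  apply: (mulfI (xn 6%N isT)).
  have -> : (x ^+ 6 - 1) * x ^+ 6 = x ^+ 12 - x ^+ 6 by ring.
  by rewrite xmu; ring.
have x4 : x ^+ 4 = x ^+ 2 - 1.
  (* [X^6 + 1] is [X^2 + 1] times [X^4 - X^2 + 1], and the first factor divides [X^4 - 1]. *)
  have x2 : x ^+ 2 + 1 != 0.
    apply: contra_neq (xn 4%N isT) => x2.
    have -> : x ^+ 4 - 1 = (x ^+ 2 + 1) * (x ^+ 2 - 1) by ring.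
    by rewrite x2 mul0r.
  apply: (mulfI x2).
  have -> : (x ^+ 2 + 1) * x ^+ 4 = x ^+ 6 + x ^+ 4 by ring.
  by rewrite x6; ring.
(* As [x] is half the sum of a square root of 3 and the fourth root of unity [x^3], that square root
   is [2 x - x^3]. *)
apply: (@tower_table_field K _ _ _ (3, 0)%ZZ 1 (x ^+ 3) (2 * x - x ^+ 3) _
  gauss_towers_ok) full _ => //.
- by rewrite !zinE; ring: x4.
- rewrite e2_pair !zinE (_ : zin K 3%ZZ = 3) //; ring: x4.
move=> V zV xV y; rewrite inE => /eqP->.
have two0 : (2 : K) != 0 by apply: (@zin_neq0 K 2).
have -> : x = (2^-1 : rat) *: (2 * x - x ^+ 3 + x ^+ 3).
  rewrite subrK mulr_natl -scaler_nat scalerA mulVf ?scale1r //.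
by rewrite rpredZ // rpredD.
Qed.

Lemma power_table_field (f v : vec) (c : certificate) (x g : K) :
  field_check (mulP f) c ->
  (let: (f0, f1, f2, f3) := f in
   x ^+ 4 + zin K f3 * x ^+ 3 + zin K f2 * x ^+ 2 + zin K f1 * x + zin K f0 = 0) ->
  <<1 & [:: g]>>%VS = fullv -> g = vec_value x (x ^+ 2) (x ^+ 3) v -> bounded (hgt c).
Proof.
move=> chk fx0 full gE; apply: (power_field fx0 full _ chk) => y.
by rewrite inE => /eqP->; exists v.
Qed.

Lemma eisenstein_field (a b w : nat) (z x : K) (ts : seq K) :
  in_towers eisenstein_towers w (a, b) ->
  3.-primitive_root z -> x ^+ 2 = e2 z (Z.of_nat a, Z.of_nat b) ->
  <<1 & ts>>%VS = fullv -> {subset ts <= [:: z; x]} -> bounded w.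
Proof.
move=> tab /prim3_eq z2E x2E full sub.
apply: (tower_table_field eisenstein_towers_ok tab z2E x2E full) => V zV xV y /sub.
by rewrite !inE => /orP[] /eqP->.
Qed.

Lemma gauss_field (a b w : nat) (z x : K) (ts : seq K) :
  in_towers gauss_towers w (a, b) ->
  iota z = 'i -> x ^+ 2 = e2 z (Z.of_nat a, Z.of_nat b) ->
  <<1 & ts>>%VS = fullv -> {subset ts <= [:: z; x]} -> bounded w.
Proof.
move=> tab /imaginary_eq z2E x2E full sub.
apply: (tower_table_field gauss_towers_ok tab z2E x2E full) => V zV xV y /sub.
by rewrite !inE => /orP[] /eqP->.
Qed.

Lemma quartic_field (p : {poly algC}) (x : K) :
  p \in [:: 'X^4 - 'X + 1; 'X^4 + 'X^2 - 'X + 1] -> root p (iota x) ->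
  <<1 & [:: x]>>%VS = fullv -> bounded 1%N.
Proof.
have gE : x = vec_value x (x ^+ 2) (x ^+ 3) (0, 1, 0, 0)%ZZ by rewrite /vec_value !zinE; ring.
rewrite !inE => /orP[] /eqP-> /rootP; rewrite !hornerE => px0 full.
  apply: (power_table_field quartic1_ok _ full gE); apply: (fmorph_inj iota).
  by rewrite !zinE !(rmorphD, rmorphN, rmorphM, rmorphXn, rmorph0, rmorph1) -[RHS]px0; ring.
apply: (power_table_field quartic2_ok _ full gE); apply: (fmorph_inj iota).
by rewrite !zinE !(rmorphD, rmorphN, rmorphM, rmorphXn, rmorph0, rmorph1) -[RHS]px0; ring.
Qed.

Lemma quartic_dagger_field (p : {poly algC}) (x : K) :
  p \in [:: 'X^4 + 2 *: 'X^2 - 2 *: 'X + 1; 'X^4 - 'X^3 + 2 *: 'X^2 - 'X + 2%:P] ->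
  root p (iota x) -> <<1 & [:: x]>>%VS = fullv -> bounded 2%N.
Proof.
have zin2 : zin K 2%ZZ = 2 by []; have zin3 : zin K 3%ZZ = 3 by [].
have zinN2 : zin K (-2)%ZZ = -2 by rewrite -[(-2)%ZZ]/(- (2))%ZZ zinN.
rewrite !inE => /orP[] /eqP-> /rootP;
  rewrite -?polyC1 !(hornerD, hornerN, hornerZ, hornerXn, hornerX, hornerC) => px0 full.
  have gE : x = vec_value x (x ^+ 2) (x ^+ 3) (0, 1, 0, 0)%ZZ by rewrite /vec_value !zinE; ring.
  apply: (power_table_field quartic3_ok _ full gE); apply: (fmorph_inj iota).
  rewrite !zinE zin2 zinN2 !(rmorphD, rmorphN, rmorphM, rmorphXn, rmorph0, rmorph1).
  by rewrite -[RHS]px0; ring.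
have fx0 : x ^+ 4 - x ^+ 3 + 2 * x ^+ 2 - x + 2 = 0.
  apply: (fmorph_inj iota).
  rewrite !(rmorphD, rmorphN, rmorphM, rmorphXn, rmorph0, rmorph1, rmorph_nat).
  by rewrite -[RHS]px0; ring.
have x4 : x ^+ 4 = x ^+ 3 - 2 * x ^+ 2 + x - 2.
  by apply/eqP; rewrite -subr_eq0 -fx0; apply/eqP; ring.
(* The unit [y = -1 + x - x^2] satisfies [y^4 + 3y^2 - y + 1 = 0], and [x = 1 - 2y - y^3]. *)
apply: (@power_table_field _ (1, -2, 0, -1)%ZZ _ (-1 + x - x ^+ 2) x quartic4_ok _ full).
  by rewrite !zinE zin3; ring: x4.
by rewrite /vec_value !zinE zinN2; ring: x4.
Qed.

Lemma quartic_ddagger_field (p : {poly algC}) (x : K) :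
  p \in [:: 'X^4 - 'X^3 + 'X + 1; 'X^4 - 'X^3 + 'X^2 + 'X + 1] ->
  root p (iota x) -> <<1 & [:: x]>>%VS = fullv -> bounded 3%N.
Proof.
have gE : x = vec_value x (x ^+ 2) (x ^+ 3) (0, 1, 0, 0)%ZZ by rewrite /vec_value !zinE; ring.
rewrite !inE => /orP[] /eqP-> /rootP; rewrite !hornerE => px0 full.
  apply: (power_table_field quartic5_ok _ full gE); apply: (fmorph_inj iota).
  by rewrite !zinE !(rmorphD, rmorphN, rmorphM, rmorphXn, rmorph0, rmorph1) -[RHS]px0; ring.
apply: (power_table_field quartic6_ok _ full gE); apply: (fmorph_inj iota).
by rewrite !zinE !(rmorphD, rmorphN, rmorphM, rmorphXn, rmorph0, rmorph1) -[RHS]px0; ring.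
Qed.

Lemma silver_field (x : K) :
  iota x = sqrtC (- 1 - sqrtC 2) -> <<1 & [:: x]>>%VS = fullv -> bounded 1%N.
Proof.
move=> xE full.
have gE : x = vec_value x (x ^+ 2) (x ^+ 3) (0, 1, 0, 0)%ZZ by rewrite /vec_value !zinE; ring.
apply: (power_table_field silver_ok _ full gE).
have zin2 : zin K 2%ZZ = 2 by [].
have x2 : iota x ^+ 2 = - 1 - sqrtC 2 by rewrite xE sqrtCK.
have s2 : sqrtC 2 ^+ 2 = 2 :> algC by rewrite sqrtCK.
have E : (iota x ^+ 2 + 1) ^+ 2 = 2 by rewrite x2 -[RHS]s2; ring.
apply: (fmorph_inj iota); rewrite !zinE zin2.
rewrite !(rmorphD, rmorphN, rmorphM, rmorphXn, rmorph0, rmorph1).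
transitivity ((iota x ^+ 2 + 1) ^+ 2 - 2); first by ring.
by rewrite E subrr.
Qed.

Lemma golden_field (x : K) :
  iota x = sqrtC (- ((1 + sqrtC 5) / 2)) -> <<1 & [:: x]>>%VS = fullv -> bounded 1%N.
Proof.
move=> xE full.
have gE : x = vec_value x (x ^+ 2) (x ^+ 3) (0, 1, 0, 0)%ZZ by rewrite /vec_value !zinE; ring.
apply: (power_table_field golden_ok _ full gE).
have x2 : iota x ^+ 2 = - ((1 + sqrtC 5) / 2) by rewrite xE sqrtCK.
have s5 : sqrtC 5 ^+ 2 = 5 :> algC by rewrite sqrtCK.
have E : (2 * iota x ^+ 2 + 1) ^+ 2 = 5 by rewrite x2 -[RHS]s5; field.
apply: (fmorph_inj iota); rewrite !zinE.
rewrite !(rmorphD, rmorphN, rmorphM, rmorphXn, rmorph0, rmorph1).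
transitivity (((2 * iota x ^+ 2 + 1) ^+ 2 - 5) / 4); first by field.
by rewrite E subrr mul0r.
Qed.

End Listed.

(** The generators lift to [K], their equations are pulled back along the injective [iota], and the
    table entry is found by computation. *)
Lemma listed_field (K : fieldExtType rat) (s : seq algC) (m : mark) :
  listed s m -> is_Qadjoin K s ->
  forall y : K, maximal_order y -> bounded_unit_sum (@maximal_order K) (mark_height m) y.
Proof.
move=> lst [iota [t [tE full]]].
case: lst tE => [mu z mu_in prim_z|p g p_in pg0|p g p_in pg0|p g p_in pg0|a b ab_in||
  a b z ab_in prim_z|a b z ab_in prim_z||d z d_in prim_z||].
- case: t full => [|x [|]] //= full [xE]; rewrite -xE fmorph_primitive_root in prim_z.
  exact: root_of_unity_field mu_in prim_z full.
- case: t full => [|x [|]] //= full [xE]; rewrite -xE in pg0.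
  exact: quartic_field p_in pg0 full.
- case: t full => [|x [|]] //= full [xE]; rewrite -xE in pg0.
  exact: quartic_dagger_field p_in pg0 full.
- case: t full => [|x [|]] //= full [xE]; rewrite -xE in pg0.
  exact: quartic_ddagger_field p_in pg0 full.
- case: t full => [|x [|]] //= full [xE].
  have /andP[b_gt0 tab] : (0 < b)%N && in_towers gauss_towers 1 (a, b).
    by apply: (allP (a := fun ab => (0 < ab.2)%N && in_towers _ _ ab) _ _ ab_in); vm_compute.
  have [z' [z'E x2E]] := sqrt_generator b_gt0 xE.
  apply: (gauss_field tab z'E x2E full) => y.
  by rewrite !inE => ->; rewrite orbT.
- case: t full => [|x [|]] //= full [xE].
  have tab : in_towers gauss_towers 2 (7, 4)%N by vm_compute.
  have [|z' [z'E x2E]] := @sqrt_generator K iota x 7 4 'i _ xE; first by [].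
  by apply: (gauss_field tab z'E x2E full) => y; rewrite !inE => ->; rewrite orbT.
- case: t full => [|x [|]] //= full [xE].
  have /andP[b_gt0 tab] : (0 < b)%N && in_towers eisenstein_towers 1 (a, b).
    by apply: (allP (a := fun ab => (0 < ab.2)%N && in_towers _ _ ab) _ _ ab_in); vm_compute.
  have [z' [z'E x2E]] := sqrt_generator b_gt0 xE.
  rewrite -z'E fmorph_primitive_root in prim_z.
  apply: (eisenstein_field tab prim_z x2E full) => y.
  by rewrite !inE => ->; rewrite orbT.
- case: t full => [|x [|]] //= full [xE].
  have /andP[b_gt0 tab] : (0 < b)%N && in_towers eisenstein_towers 2 (a, b).
    by apply: (allP (a := fun ab => (0 < ab.2)%N && in_towers _ _ ab) _ _ ab_in); vm_compute.
  have [z' [z'E x2E]] := sqrt_generator b_gt0 xE.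
  rewrite -z'E fmorph_primitive_root in prim_z.
  apply: (eisenstein_field tab prim_z x2E full) => y.
  by rewrite !inE => ->; rewrite orbT.
- case: t full => [|z [|x [|]]] //= full [zE xE].
  have tab : in_towers gauss_towers 1 (5, 0)%N by vm_compute.
  have x2E : x ^+ 2 = e2 z (Z.of_nat 5, Z.of_nat 0).
    apply: (fmorph_inj iota); rewrite rmorphXn xE sqrtCK.
    by rewrite e2_pair !zin_nat mul0r addr0 rmorph_nat.
  by apply: (gauss_field tab zE x2E full) => y.
- case: t full => [|z' [|x [|]]] //= full [zE xE].
  rewrite -zE fmorph_primitive_root in prim_z.
  have tab : in_towers eisenstein_towers 1 (d, 0)%N.
    by apply: (allP (a := fun d => in_towers _ _ (d, 0)%N) _ _ d_in); vm_compute.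
  have x2E : x ^+ 2 = e2 z' (Z.of_nat d, Z.of_nat 0).
    apply: (fmorph_inj iota); rewrite rmorphXn xE sqrtCK.
    by rewrite e2_pair !zin_nat mul0r addr0 rmorph_nat.
  by apply: (eisenstein_field tab prim_z x2E full) => y.
- case: t full => [|x [|]] //= full [xE]; exact: silver_field xE full.
case: t full => [|x [|]] //= full [xE]; exact: golden_field xE full.
Qed.

Theorem theorem1p2 (K : fieldExtType rat) (s : seq algC) (m : mark) :
  listed s m -> is_Qadjoin K s ->
  [/\ height_le (omega_field K) (Fin 3),
      m = Unmarked -> DUG_field K /\ omega_field K = Fin 1,
      m = Dagger -> height_le (omega_field K) (Fin 2) &
      m = DoubleDagger -> height_le (omega_field K) (Fin 3)].
Proof.
move=> lst adj; have rep := listed_field lst adj.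
have le_m := maximal_order_le rep.
split.
- by move: le_m; case: (omega_field K) => //= n; case: (m) => // /leq_trans; apply.
- by move=> mE; rewrite mE in rep; split; [apply: maximal_order_DUG|apply: maximal_order_eq1].
- by move=> mE; rewrite mE in le_m.
by move=> mE; rewrite mE in le_m.
Qed.
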